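(* Let $E_1,\ldots,E_m,F$ be (real) Banach lattices. Suppose that $E_1^*,\ldots,E_m^*$ have the positive Schur property and that either $F^*$ has the dual positive Schur property or every positive disjoint bounded sequence in $F^*$ is order bounded. If $A\colon E_1\times\cdots\times E_m\longrightarrow F$ is a regular $m$-linear operator, then $\|A^{*[m+1]}(x_{1,n}^{**},\ldots,x_{m,n}^{**})\|\longrightarrow 0$ for every positive weak$^*$-null sequence $(x_{m,n}^{**})_{n=1}^\infty$ in $E_m^{**}$ and all bounded sequences $(x_{k,n}^{**})_{n=1}^\infty$ in $E_k^{**}$, $k=1,\ldots,m-1$. In particular, $A$ and its Aron-Berner extension $A^{*[m+1]}$ are almost Dunford-Pettis.
   Context: A sequence $(x_n)$ in a Banach lattice is disjoint if $|x_n|\wedge|x_k|=0$ for $n\ne k$. A Banach lattice $E$ has the positive Schur property if positive weakly null sequences in $E$ are norm null (equivalently, disjoint weakly null sequences, or disjoint positive weakly null sequences, are norm null). A Banach lattice $E$ has the dual positive Schur property if every positive weak$^*$-null sequence in $E^*$ is norm null. An $m$-linear operator between Banach lattices is positive if it maps tuples of positive elements to positive elements, and regular if it is a difference of two positive $m$-linear operators (such operators are continuous). For Banach lattices $E_1,\ldots,E_m$ and a Banach space $G$, an $m$-linear operator $A\colon E_1\times\cdots\times E_m\to G$ is almost Dunford-Pettis if $(A(x_{1,n},\ldots,x_{m,n}))_{n=1}^\infty$ is norm null in $G$ whenever $(x_{j,n})_{n=1}^\infty$ is a disjoint weakly null sequence in $E_j$, $j=1,\ldots,m$. The weak$^*$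 topology on $E_m^{**}$ is $\sigma(E_m^{**},E_m^* )$. The Aron-Berner extension $A^{*[m+1]}\colon E_1^{**}\times\cdots\times E_m^{**}\to F^{**}$ of a continuous $m$-linear operator $A\colon E_1\times\cdots\times E_m\to F$ is defined as follows. For $x_i^{**}\in E_i^{**}$ and a continuous $i$-linear form $B$ on $E_1\times\cdots\times E_i$, let $\overline{x_i^{**}}^{\theta}(B)$ be the continuous $(i-1)$-linear form on $E_1\times\cdots\times E_{i-1}$ (a real number if $i=1$) given by $\overline{x_i^{**}}^{\theta}(B)(x_1,\ldots,x_{i-1})=x_i^{**}\big(B(x_1,\ldots,x_{i-1},\bullet)\big)$, where $B(x_1,\ldots,x_{i-1},\bullet)\in E_i^*$ is the functional $x_i\mapsto B(x_1,\ldots,x_i)$. Then $$A^{*[m+1]}(x_1^{**},\ldots,x_m^{**})(y^* )=\big(\overline{x_1^{**}}^{\theta}\circ\cdots\circ\overline{x_m^{**}}^{\theta}\big)(y^*\circ A),\quad y^*\in F^*.$$ *)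

(* Defs.v *)
From HB Require Import structures.
From mathcomp Require Import all_boot all_order all_algebra.
From mathcomp Require Import all_classical all_reals.
From mathcomp Require Import topology normedtype sequences.

Set Implicit Arguments.
Unset Strict Implicit.
Unset Printing Implicit Defensive.

Import Order.TTheory GRing.Theory Num.Theory.
Import numFieldTopology.Exports numFieldNormedType.Exports.

Local Open Scope classical_set_scope.
Local Open Scope ring_scope.

(* The order is a field of the mixin, and not the one of Order.POrder, because
   the numeric structures of MathComp are not declared above a join of
   Order.POrder and NormedModule, so that no structure can inherit both. *)
HB.mixin Record isBanachLattice (R : realType) E
    & CompleteNormedModule R E := {
  bl_le : rel E ;
  bl_join : E -> E -> E ;
  bl_meet : E -> E -> E ;
  bl_lexx : reflexive bl_le ;
  bl_le_anti : antisymmetric bl_le ;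
  bl_le_trans : transitive bl_le ;
  bl_leUx : forall x y z : E, bl_le (bl_join x y) z = bl_le x z && bl_le y z ;
  bl_lexI : forall x y z : E, bl_le z (bl_meet x y) = bl_le z x && bl_le z y ;
  bl_lerD2r : forall x y z : E, bl_le x y -> bl_le (x + z) (y + z) ;
  bl_scaler_ge0 : forall (a : R) (x : E),
    0 <= a -> bl_le 0 x -> bl_le 0 (a *: x) ;
  bl_ler_norm : forall x y : E,
    bl_le (bl_join x (- x)) (bl_join y (- y)) -> `|x| <= `|y|
}.

#[short(type="banachLatticeType")]
HB.structure Definition BanachLattice (R : realType) :=
  {E of CompleteNormedModule R E & isBanachLattice R E}.

Notation "x [<=] y" := (bl_le x y) (at level 70, no associativity).

Definition modulus (R : realType) (E : banachLatticeType R) (x : E) : E :=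
  bl_join x (- x).

Section BanachLatticeTheory.
Context {R : realType} {E : banachLatticeType R}.
Implicit Types x y z : E.

Lemma bl_trans x y z : x [<=] y -> y [<=] z -> x [<=] z.
Proof. exact: bl_le_trans. Qed.

Lemma bl_leUl x y : x [<=] bl_join x y.
Proof. by have := bl_lexx (bl_join x y); rewrite bl_leUx => /andP[]. Qed.

Lemma bl_leUr x y : y [<=] bl_join x y.
Proof. by have := bl_lexx (bl_join x y); rewrite bl_leUx => /andP[]. Qed.

Lemma bl_leIl x y : bl_meet x y [<=] x.
Proof. by have := bl_lexx (bl_meet x y); rewrite bl_lexI => /andP[]. Qed.

Lemma bl_leIr x y : bl_meet x y [<=] y.
Proof. by have := bl_lexx (bl_meet x y); rewrite bl_lexI => /andP[]. Qed.

Lemma bl_joinC x y : bl_join x y = bl_join y x.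
Proof. by apply: bl_le_anti; rewrite !bl_leUx !bl_leUl !bl_leUr. Qed.

Lemma bl_join_idl x y : y [<=] x -> bl_join x y = x.
Proof. by move=> yx; apply: bl_le_anti; rewrite bl_leUx bl_lexx yx bl_leUl. Qed.

Lemma bl_leD2r z x y : (x + z [<=] y + z) = (x [<=] y).
Proof.
apply/idP/idP => [/(@bl_lerD2r _ _ _ _ (- z))|]; last exact: bl_lerD2r.
by rewrite !addrK.
Qed.

Lemma bl_leD2l z x y : (z + x [<=] z + y) = (x [<=] y).
Proof. by rewrite ![z + _]addrC bl_leD2r. Qed.

Lemma bl_leD x y z t : x [<=] y -> z [<=] t -> x + z [<=] y + t.
Proof.
move=> xy zt; apply: (@bl_trans _ (y + z)).
  by rewrite bl_leD2r.
by rewrite bl_leD2l.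
Qed.

Lemma bl_subr_ge0 x y : (0 [<=] y - x) = (x [<=] y).
Proof. by rewrite -(bl_leD2r x) add0r subrK. Qed.

Lemma bl_subr_le x y z : (x - y [<=] z) = (x [<=] z + y).
Proof. by rewrite -(bl_leD2r y) subrK. Qed.

Lemma bl_leN2 x y : (- x [<=] - y) = (y [<=] x).
Proof. by rewrite -bl_subr_ge0 opprK addrC bl_subr_ge0. Qed.

Lemma bl_addr_ge0 x y : 0 [<=] x -> 0 [<=] y -> 0 [<=] x + y.
Proof. by move=> x0 y0; rewrite -[0]addr0 bl_leD. Qed.

Lemma bl_joinD x y z : bl_join x y + z = bl_join (x + z) (y + z).
Proof.
apply: bl_le_anti; apply/andP; split; last first.
  by rewrite bl_leUx !bl_leD2r bl_leUl bl_leUr.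
rewrite -[X in _ [<=] X](subrK z) bl_leD2r bl_leUx.
by rewrite -(bl_leD2r z x) -(bl_leD2r z y) subrK bl_leUl bl_leUr.
Qed.

Definition ppart x : E := bl_join x 0.

Lemma ppart_ge0 x : 0 [<=] ppart x. Proof. exact: bl_leUr. Qed.

Lemma ppart_ge x : x [<=] ppart x. Proof. exact: bl_leUl. Qed.

Lemma ppart_id x : 0 [<=] x -> ppart x = x.
Proof. exact: bl_join_idl. Qed.

Lemma ppart_subE x : x = ppart x - ppart (- x).
Proof.
apply/eqP; rewrite eq_sym subr_eq; apply/eqP.
by rewrite addrC /ppart bl_joinD addNr add0r bl_joinC.
Qed.

Lemma modulus_id x : 0 [<=] x -> modulus x = x.
Proof.
move=> x0; rewrite /modulus bl_join_idl//.
by apply: (bl_trans _ x0); rewrite -[X in _ [<=] X]oppr0 bl_leN2.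
Qed.

Lemma modulusN x : modulus (- x) = modulus x.
Proof. by rewrite /modulus opprK bl_joinC. Qed.

Lemma modulus_ge x : x [<=] modulus x. Proof. exact: bl_leUl. Qed.

Lemma modulus_geN x : - x [<=] modulus x. Proof. exact: bl_leUr. Qed.

Lemma modulus_ge0 x : 0 [<=] modulus x.
Proof.
have h : 0 [<=] 2^-1 *: (modulus x + modulus x).
  by rewrite bl_scaler_ge0 ?invr_ge0// -(subrr x) bl_leD ?bl_leUl ?bl_leUr.
by move: h; rewrite -mulr2n -(scaler_nat 2 (modulus x)) scalerA mulVf ?scale1r// pnatr_eq0.
Qed.

Lemma modulus_le x y : x [<=] y -> - x [<=] y -> modulus x [<=] y.
Proof. by move=> xy nxy; rewrite /modulus bl_leUx xy. Qed.

Lemma modulus_mod x : modulus (modulus x) = modulus x.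
Proof. by rewrite modulus_id// modulus_ge0. Qed.

Lemma modulus_ler_norm x y : modulus x [<=] modulus y -> `|x| <= `|y|.
Proof. exact: bl_ler_norm. Qed.

Lemma norm_modulus x : `|modulus x| = `|x|.
Proof.
by apply/eqP; rewrite eq_le !modulus_ler_norm// modulus_mod bl_lexx.
Qed.

Lemma ge0_ler_norm x y : 0 [<=] x -> x [<=] y -> `|x| <= `|y|.
Proof.
move=> x0 xy; apply: modulus_ler_norm; rewrite !modulus_id//.
exact: bl_trans xy.
Qed.

Lemma norm_ppart x : `|ppart x| <= `|x|.
Proof.
apply: modulus_ler_norm; rewrite modulus_id ?ppart_ge0//.
by rewrite bl_leUx modulus_ge modulus_ge0.
Qed.

Lemma riesz_decomp x y z : 0 [<=] x -> 0 [<=] y -> 0 [<=] z -> z [<=] x + y ->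
  exists z1 z2, [/\ z = z1 + z2, 0 [<=] z1 /\ z1 [<=] x &
                    0 [<=] z2 /\ z2 [<=] y].
Proof.
move=> x0 y0 z0 zxy; pose z1 := bl_meet z x.
exists z1, (z - z1); split; first by rewrite addrC subrK.
  by rewrite bl_lexI z0 x0 bl_leIr.
rewrite bl_subr_ge0 bl_leIl; split => //.
rewrite bl_subr_le addrC -bl_subr_le bl_lexI bl_subr_le.
by rewrite -[X in X [<=] _]addr0 bl_leD2l y0 bl_subr_le.
Qed.

Lemma bl_subr_norm_le x y : 0 [<=] y -> y [<=] x -> `|y + y - x| <= `|x|.
Proof.
move=> y0 yx; apply: modulus_ler_norm.
rewrite (@modulus_id x) ?(bl_trans y0)//; apply: modulus_le.
  by rewrite bl_subr_le bl_leD.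
by rewrite opprB bl_subr_le -[X in X [<=] _]addr0 bl_leD2l bl_addr_ge0.
Qed.

End BanachLatticeTheory.

Record dual (R : realType) (E : banachLatticeType R) := Dual {
  dual_fun :> E -> R ;
  dual_linear : scalar dual_fun ;
  dual_continuous : continuous dual_fun
}.

Section DualNormed.
Context {R : realType} {E : banachLatticeType R}.
Implicit Types (f g h : dual E) (x y z : E) (a : R).

Lemma dualP f g : f =1 g -> f = g.
Proof.
case: f => f lf cf; case: g => g lg cg /= /funext fg; subst g.
by congr Dual; exact: Prop_irrelevance.
Qed.

Lemma dualD f x y : f (x + y) = f x + f y.
Proof. by have := dual_linear f 1 x y; rewrite scale1r mul1r. Qed.

Lemma dual0 f : f 0 = 0.
Proof.
by have /eqP := dualD f 0 0; rewrite addr0 -subr_eq0 opprD addNKr oppr_eq0 => /eqP.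
Qed.

Lemma dualZ f a x : f (a *: x) = a * f x.
Proof. by have := dual_linear f a x 0; rewrite dual0 !addr0. Qed.

Lemma dualN f x : f (- x) = - f x.
Proof. by rewrite -scaleN1r dualZ mulN1r. Qed.

Lemma dualB f x y : f (x - y) = f x - f y.
Proof. by rewrite dualD dualN. Qed.

Lemma scalar_bounded_continuous (f : E -> R) (M : R) : scalar f ->
  (forall x, `|f x| <= M * `|x|) -> continuous f.
Proof.
move=> lf fM.
pose g : {linear E -> R^o} :=
  HB.pack (f : E -> R^o) (GRing.isLinear.Build R E R^o *:%R f lf).
have: bounded_near g (nbhs 0).
  apply/linear_boundedP; near=> r => x; apply: (le_trans (fM x)).
  by rewrite ler_wpM2r//; near: r; apply: nbhs_pinfty_ge; rewrite num_real.
by move/bounded_linear_continuous.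
Unshelve. all: by end_near. Qed.

Lemma scalar_continuous_bounded (f : E -> R) : scalar f -> continuous f ->
  exists2 M : R, 0 <= M & forall x, `|f x| <= M * `|x|.
Proof.
move=> lf cf.
pose g : {linear E -> R^o} :=
  HB.pack (f : E -> R^o) (GRing.isLinear.Build R E R^o *:%R f lf).
have : bounded_near g (nbhs 0) by apply: continuous_linear_bounded; exact: cf.
move=> /linear_boundedP gb.
near +oo_R => r; exists r; last by near: r.
by near: r; apply: nbhs_pinfty_ge; rewrite num_real.
Unshelve. all: by end_near. Qed.

Lemma dual_bounded f : exists2 M : R, 0 <= M & forall x, `|f x| <= M * `|x|.
Proof. exact: scalar_continuous_bounded (@dual_linear _ _ f) (@dual_continuous _ _ f). Qed.

Definition dual_of_bound (f : E -> R) (lf : scalar f) (M : R)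
    (fM : forall x, `|f x| <= M * `|x|) : dual E :=
  Dual lf (scalar_bounded_continuous lf fM).

Fact dual_zero_linear : scalar (fun _ : E => 0 : R).
Proof. by move=> a x y; rewrite mulr0 addr0. Qed.
Fact dual_zero_bound x : `|0 : R| <= 0 * `|x|.
Proof. by rewrite normr0 mul0r. Qed.
Definition dual_zero : dual E := dual_of_bound dual_zero_linear dual_zero_bound.

Fact dual_opp_linear f : scalar (fun x => - f x).
Proof. by move=> a x y; rewrite dual_linear opprD mulrN. Qed.
Fact dual_opp_continuous f : continuous (fun x => - f x).
Proof. by move=> x; apply: cvgN; exact: dual_continuous. Qed.
Definition dual_opp f : dual E :=
  Dual (dual_opp_linear f) (@dual_opp_continuous f).

Fact dual_add_linear f g : scalar (fun x => f x + g x).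
Proof. by move=> a x y; rewrite !dual_linear mulrDr addrACA. Qed.
Fact dual_add_continuous f g : continuous (fun x => f x + g x).
Proof. by move=> x; apply: cvgD; exact: dual_continuous. Qed.
Definition dual_add f g : dual E :=
  Dual (dual_add_linear f g) (@dual_add_continuous f g).

Fact dual_scale_linear a f : scalar (fun x => a * f x).
Proof. by move=> b x y; rewrite dual_linear mulrDr mulrCA. Qed.
Fact dual_scale_continuous a f : continuous (fun x => a * f x).
Proof. by move=> x; apply: cvgM; [exact: cvg_cst|exact: dual_continuous]. Qed.
Definition dual_scale a f : dual E :=
  Dual (dual_scale_linear a f) (@dual_scale_continuous a f).

Fact dual_addA : associative dual_add.
Proof. by move=> f g h; apply: dualP => x /=; rewrite addrA. Qed.
Fact dual_addC : commutative dual_add.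
Proof. by move=> f g; apply: dualP => x /=; rewrite addrC. Qed.
Fact dual_add0 : left_id dual_zero dual_add.
Proof. by move=> f; apply: dualP => x /=; rewrite add0r. Qed.
Fact dual_addN : left_inverse dual_zero dual_opp dual_add.
Proof. by move=> f; apply: dualP => x /=; rewrite addNr. Qed.

HB.instance Definition _ := gen_eqMixin (dual E).
HB.instance Definition _ := gen_choiceMixin (dual E).
HB.instance Definition _ := GRing.isZmodule.Build (dual E)
  dual_addA dual_addC dual_add0 dual_addN.

Fact dual_scaleA a b f : dual_scale a (dual_scale b f) = dual_scale (a * b) f.
Proof. by apply: dualP => x /=; rewrite mulrA. Qed.
Fact dual_scale1 : left_id 1 dual_scale.
Proof. by move=> f; apply: dualP => x /=; rewrite mul1r. Qed.
Fact dual_scaleDr : right_distributive dual_scale +%R.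
Proof. by move=> a f g; apply: dualP => x /=; rewrite mulrDr. Qed.
Fact dual_scaleDl f : {morph dual_scale^~ f : a b / a + b}.
Proof. by move=> a b; apply: dualP => x /=; rewrite mulrDl. Qed.

HB.instance Definition _ := GRing.Zmodule_isLmodule.Build R (dual E)
  dual_scaleA dual_scale1 dual_scaleDr dual_scaleDl.

Lemma dualDE f g x : (f + g) x = f x + g x. Proof. by []. Qed.
Lemma dualNE f x : (- f) x = - f x. Proof. by []. Qed.
Lemma dualBE f g x : (f - g) x = f x - g x. Proof. by []. Qed.
Lemma dualZE a f x : (a *: f) x = a * f x. Proof. by []. Qed.
Lemma dual0E x : (0 : dual E) x = 0. Proof. by []. Qed.

Definition dual_norm f : R := sup [set `|f x| | x in [set x | `|x| <= 1]].

Lemma has_sup_dual_norm f : has_sup [set `|f x| | x in [set x | `|x| <= 1]].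
Proof.
split; first by exists `|f 0|, 0 => //=; rewrite normr0.
have [M M0 fM] := dual_bounded f; exists M => _ [x /= x1 <-].
by rewrite (le_trans (fM x))// -[leRHS]mulr1 ler_wpM2l.
Qed.

Lemma dual_norm_ge0 f : 0 <= dual_norm f.
Proof.
apply: (@le_trans _ _ `|f 0|) => //; apply: (sup_upper_bound (has_sup_dual_norm f)).
by exists 0 => //=; rewrite normr0.
Qed.

Lemma dual_normP f x : `|f x| <= dual_norm f * `|x|.
Proof.
have [->|x0] := eqVneq x 0; first by rewrite dual0 !normr0 mulr0.
have nx : 0 < `|x| by rewrite normr_gt0.
rewrite -ler_pdivrMr// -[X in _ * X]ger0_norm ?invr_ge0// -normrM mulrC -dualZ.
apply: (sup_upper_bound (has_sup_dual_norm f)); exists (`|x|^-1 *: x) => //=.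
by rewrite normrZ ger0_norm ?invr_ge0// mulVf// gt_eqF.
Qed.

Lemma dual_norm_le f (M : R) : 0 <= M -> (forall x, `|f x| <= M * `|x|) ->
  dual_norm f <= M.
Proof.
move=> M0 fM; apply: ge_sup; first by case: (has_sup_dual_norm f).
by move=> _ [x /= x1 <-]; rewrite (le_trans (fM x))// -[leRHS]mulr1 ler_wpM2l.
Qed.

Fact ler_dual_normD f g : dual_norm (f + g) <= dual_norm f + dual_norm g.
Proof.
apply: dual_norm_le => [|x]; first by rewrite addr_ge0 ?dual_norm_ge0.
by rewrite (le_trans (ler_normD _ _))// mulrDl lerD// dual_normP.
Qed.

Fact dual_normZ a f : dual_norm (a *: f) = `|a| * dual_norm f.
Proof.
have le_normZ b g : dual_norm (b *: g) <= `|b| * dual_norm g.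
  apply: dual_norm_le => [|x]; first by rewrite mulr_ge0 ?dual_norm_ge0.
  by rewrite dualZE normrM -mulrA ler_wpM2l// dual_normP.
apply/eqP; rewrite eq_le le_normZ/=.
have [->|a0] := eqVneq a 0; first by rewrite normr0 mul0r dual_norm_ge0.
rewrite -ler_pdivlMl ?normr_gt0// -normfV.
by rewrite (le_trans _ (le_normZ _ _))// scalerA mulVf// scale1r.
Qed.

Fact dual_norm0_eq0 f : dual_norm f = 0 -> f = 0.
Proof.
move=> f0; apply: dualP => x; have := dual_normP f x.
by rewrite f0 mul0r normr_le0 => /eqP.
Qed.

HB.instance Definition _ := Lmodule_isNormed.Build R (dual E)
  ler_dual_normD dual_normZ dual_norm0_eq0.

Lemma ler_dual f x : `|f x| <= `|f| * `|x|. Proof. exact: dual_normP. Qed.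

Fact dual_complete (F : set_system (dual E)) :
  ProperFilter F -> cauchy F -> cvg F.
Proof.
move=> FF /cauchy_ballP Fc.
have Fc' (e : R) : 0 < e ->
    exists2 A, F A & forall f g, A f -> A g -> `|f - g| < e.
  move=> e0; have [[A B] /= [FA FB] AB] := Fc e e0.
  exists (A `&` B); first exact: filterI.
  move=> f g [Af _] [_ Bg]; have := AB (f, g) (conj Af Bg).
  by rewrite -ball_normE.
have Fx x : cvg ((fun f : dual E => f x) @ F).
  apply: R_complete; apply/cauchy_ballP => e e0.
  have n0 : 0 < `|x| + 1 by rewrite ltr_wpDl.
  have [A FA Ae] := Fc' _ (divr_gt0 e0 n0).
  pose ev (f : dual E) : R := f x.
  have FAx : F (ev @^-1` (ev @` A)).
    by apply: filterS FA => f Af; exists f.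
  exists (ev @` A, ev @` A); first by split; exact: FAx.
  move=> [_ _] /= [[f Af <-] [g Ag <-]]; rewrite -ball_normE /=.
  rewrite -dualBE (le_lt_trans (ler_dual _ _))//.
  apply: (@le_lt_trans _ _ (`|f - g| * (`|x| + 1))).
    by rewrite ler_wpM2l// lerDl.
  by rewrite -ltr_pdivlMr// Ae.
pose l x : R := lim ((fun f : dual E => f x) @ F).
have llin : scalar l.
  move=> a x y; apply: cvg_lim => //.
  under eq_cvg do rewrite dual_linear.
  by apply: cvgD; [apply: cvgMr; exact: Fx|exact: Fx].
have lbound (e : R) : 0 < e ->
    F [set f : dual E | forall x, `|f x - l x| <= e * `|x|].
  move=> e0; have [A FA Ae] := Fc' e e0.
  apply: filterS (FA) => f Af x.
  have fgl : (fun g : dual E => `|f x - g x|) @ F --> `|f x - l x|.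
    by apply: cvg_norm; apply: cvgB; [exact: cvg_cst|exact: Fx].
  apply: (cvgr_to_le fgl).
  apply: filterS FA => g Ag; rewrite -dualBE (le_trans (ler_dual _ _))//.
  by rewrite ler_wpM2r// ltW// Ae.
have [f0 f0l] : exists f : dual E, forall x, `|f x - l x| <= 1 * `|x|.
  by have /filter_ex := lbound 1 ltr01.
have lb x : `|l x| <= (`|f0| + 1) * `|x|.
  rewrite -[l x](subrK (f0 x)) (le_trans (ler_normD _ _))// distrC addrC mulrDl.
  by rewrite lerD// ler_dual.
apply/cvg_ex; exists (dual_of_bound llin lb).
apply/cvgrPdist_le => e e0; have := lbound e e0; apply: filterS => f fl.
by apply: dual_norm_le => [|x]; [exact: ltW|rewrite dualBE distrC].
Qed.

HB.instance Definition _ := Uniform_isComplete.Build (dual E) dual_complete.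

End DualNormed.

Lemma ppart_add_le (R : realType) (E : banachLatticeType R) (x : E) :
  ppart x + ppart (- x) [<=] modulus x.
Proof.
rewrite {1}/ppart bl_joinD add0r bl_leUx {1}/ppart [x + _]addrC bl_joinD.
rewrite addNr add0r [X in _ && X]bl_leUx modulus_geN modulus_ge0.
by rewrite bl_leUx modulus_ge0 modulus_ge.
Qed.

(* The lattice operations of the dual are given by the Riesz-Kantorovich
   formula for the positive part of a functional. *)
Section DualLattice.
Context {R : realType} {E : banachLatticeType R}.
Implicit Types (f g h : dual E) (x y z : E) (a : R).

Lemma cone_extend (q : E -> R) :
  (forall x y, 0 [<=] x -> 0 [<=] y -> q (x + y) = q x + q y) ->
  (forall a x, 0 <= a -> 0 [<=] x -> q (a *: x) = a * q x) ->
  scalar (fun x => q (ppart x) - q (ppart (- x))).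
Proof.
move=> qD qZ; set e := fun x => _.
have eE x y z : x = y - z -> 0 [<=] y -> 0 [<=] z -> e x = q y - q z.
  move=> xyz y0 z0; have := ppart_subE x; rewrite {1}xyz /e.
  have := ppart_ge0 x; have := ppart_ge0 (- x).
  move: (ppart x) (ppart (- x)) => u v v0 u0 /eqP.
  rewrite subr_eq addrAC eq_sym subr_eq => /eqP /(congr1 q).
  rewrite !qD// => /eqP H; apply/eqP.
  by rewrite subr_eq addrAC eq_sym subr_eq eq_sym.
move=> a x y.
have eD u v : e (u + v) = e u + e v.
  rewrite (@eE _ (ppart u + ppart v) (ppart (- u) + ppart (- v))).
  - by rewrite !qD ?ppart_ge0// opprD addrACA.
  - by rewrite opprD addrACA -!ppart_subE.
  - by rewrite bl_addr_ge0 ?ppart_ge0.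
  - by rewrite bl_addr_ge0 ?ppart_ge0.
rewrite eD; congr (_ + _).
have [a0|/ltW a0] := leP 0 a.
  rewrite (@eE _ (a *: ppart x) (a *: ppart (- x))) ?bl_scaler_ge0 ?ppart_ge0//.
    by rewrite !qZ ?ppart_ge0// mulrBr.
  by rewrite -scalerBr -ppart_subE.
have na0 : 0 <= - a by rewrite oppr_ge0.
rewrite (@eE _ ((- a) *: ppart (- x)) ((- a) *: ppart x)) ?bl_scaler_ge0 ?ppart_ge0//.
  by rewrite !qZ ?ppart_ge0// -mulrBr -opprB mulrNN.
by rewrite -scalerBr scaleNr -scalerN opprB -ppart_subE.
Qed.

Definition rk h x : R := sup [set h y | y in [set y | 0 [<=] y /\ y [<=] x]].

Lemma has_sup_rk h x : 0 [<=] x ->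
  has_sup [set h y | y in [set y | 0 [<=] y /\ y [<=] x]].
Proof.
move=> x0; split; first by exists (h 0), 0 => //; split; rewrite ?bl_lexx.
exists (`|h| * `|x|) => _ [y /= [y0 yx] <-].
rewrite (le_trans (ler_norm _))// (le_trans (ler_dual _ _))// ler_wpM2l//.
exact: ge0_ler_norm.
Qed.

Lemma rk_ub h x y : 0 [<=] y -> y [<=] x -> h y <= rk h x.
Proof.
move=> y0 yx; apply: (sup_upper_bound (has_sup_rk h (bl_trans y0 yx))).
by exists y.
Qed.

Lemma rk_le h x (M : R) : 0 [<=] x ->
  (forall y, 0 [<=] y -> y [<=] x -> h y <= M) -> rk h x <= M.
Proof.
move=> x0 hM; apply: ge_sup; first by case: (has_sup_rk h x0).
by move=> _ [y /= [y0 yx] <-]; exact: hM.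
Qed.

Lemma rk_ge0 h x : 0 [<=] x -> 0 <= rk h x.
Proof. by move=> x0; rewrite -(dual0 h) rk_ub ?bl_lexx. Qed.

Lemma rkD h x y : 0 [<=] x -> 0 [<=] y -> rk h (x + y) = rk h x + rk h y.
Proof.
move=> x0 y0; apply/eqP; rewrite eq_le; apply/andP; split.
  apply: rk_le => [|z z0 zxy]; first exact: bl_addr_ge0.
  have [z1 [z2 [-> [z10 z1x] [z20 z2y]]]] := riesz_decomp x0 y0 z0 zxy.
  by rewrite dualD lerD// rk_ub.
rewrite -lerBrDr; apply: rk_le => // u u0 ux.
rewrite lerBrDr -lerBrDl; apply: rk_le => // v v0 vy.
by rewrite lerBrDl -dualD rk_ub ?bl_addr_ge0 ?bl_leD.
Qed.

Lemma bl_scaler_le a x y : 0 <= a -> x [<=] y -> a *: x [<=] a *: y.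
Proof.
move=> a0 xy; rewrite -bl_subr_ge0 -scalerBr.
by rewrite bl_scaler_ge0// bl_subr_ge0.
Qed.

Lemma rkZ h a x : 0 <= a -> 0 [<=] x -> rk h (a *: x) = a * rk h x.
Proof.
have rkZle b y : 0 <= b -> 0 [<=] y -> b * rk h y <= rk h (b *: y).
  move=> b0 y0; have [->|bn0] := eqVneq b 0.
    by rewrite mul0r scale0r rk_ge0 ?bl_lexx.
  have bp : 0 < b by rewrite lt_neqAle eq_sym bn0.
  rewrite -ler_pdivlMl//; apply: rk_le => // z z0 zy.
  by rewrite ler_pdivlMl// -dualZ rk_ub ?bl_scaler_ge0 ?bl_scaler_le.
move=> a0 x0; apply/eqP; rewrite eq_le rkZle// andbT.
have [->|an0] := eqVneq a 0.
  rewrite mul0r scale0r; apply: rk_le => [|y y0 y0']; first exact: bl_lexx.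
  by rewrite (@bl_le_anti _ _ y 0) ?dual0// y0 y0'.
have ap : 0 < a by rewrite lt_neqAle eq_sym an0.
rewrite -ler_pdivrMl// (le_trans (rkZle _ _ _ _))// ?invr_ge0 ?bl_scaler_ge0//.
by rewrite scalerA mulVf// scale1r.
Qed.

Lemma rk_norm h x : 0 [<=] x -> rk h x <= `|h| * `|x|.
Proof.
move=> x0; apply: rk_le => // y y0 yx.
rewrite (le_trans (ler_norm _))// (le_trans (ler_dual _ _))// ler_wpM2l//.
exact: ge0_ler_norm.
Qed.

Fact dual_ppart_linear h : scalar (fun x => rk h (ppart x) - rk h (ppart (- x))).
Proof. by apply: cone_extend; [exact: rkD|exact: rkZ]. Qed.

Fact dual_ppart_bound h x :
  `|rk h (ppart x) - rk h (ppart (- x))| <= (`|h| + `|h|) * `|x|.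
Proof.
rewrite (le_trans (ler_normB _ _))// mulrDl.
rewrite !ger0_norm ?rk_ge0 ?ppart_ge0// lerD//.
  by rewrite (le_trans (rk_norm _ _)) ?ppart_ge0// ler_wpM2l// norm_ppart.
rewrite (le_trans (rk_norm _ _)) ?ppart_ge0// ler_wpM2l//.
by rewrite -[X in _ <= X]normrN norm_ppart.
Qed.

Definition dual_ppart h : dual E :=
  dual_of_bound (dual_ppart_linear h) (dual_ppart_bound h).

Lemma dual_ppartE h x : 0 [<=] x -> dual_ppart h x = rk h x.
Proof.
move=> x0 /=; have -> : ppart (- x) = 0.
  rewrite /ppart bl_joinC bl_join_idl//.
  by rewrite -[X in _ [<=] X]oppr0 bl_leN2.
have := rkZ h (lexx 0) x0; rewrite scale0r mul0r => ->.
by rewrite ppart_id// subr0.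
Qed.

Definition dual_le : rel (dual E) :=
  fun f g => `[< forall x, 0 [<=] x -> f x <= g x >].

Lemma dual_leP f g :
  reflect (forall x, 0 [<=] x -> f x <= g x) (dual_le f g).
Proof. exact: asboolP. Qed.

Definition dual_join f g : dual E := g + dual_ppart (f - g).
Definition dual_meet f g : dual E := f - dual_ppart (f - g).

Fact dual_lexx : reflexive dual_le.
Proof. by move=> f; apply/dual_leP. Qed.

Fact dual_le_anti : antisymmetric dual_le.
Proof.
move=> f g /andP[/dual_leP fg /dual_leP gf]; apply: dualP => x.
rewrite (ppart_subE x) !dualB.
by congr (_ - _); apply/eqP; rewrite eq_le fg ?gf ?ppart_ge0.
Qed.

Fact dual_le_trans : transitive dual_le.
Proof.
move=> g f h /dual_leP fg /dual_leP gh; apply/dual_leP => x x0.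
by rewrite (le_trans (fg x x0))// gh.
Qed.

Lemma dual_ppart_le h g :
  dual_le (dual_ppart h) g = dual_le h g && dual_le 0 g.
Proof.
apply/idP/andP => [/dual_leP hg|[/dual_leP hg /dual_leP g0]].
  split; apply/dual_leP => x x0.
    by rewrite (le_trans _ (hg x x0))// dual_ppartE// rk_ub ?bl_lexx.
  by rewrite (le_trans _ (hg x x0))// dual_ppartE// rk_ge0.
apply/dual_leP => x x0; rewrite dual_ppartE//; apply: rk_le => // y y0 yx.
rewrite (le_trans (hg y y0))// -subr_ge0 -dualB.
by rewrite (le_trans _ (g0 _ _)) ?bl_subr_ge0.
Qed.

Lemma dual_leD2r h f g : dual_le (f + h) (g + h) = dual_le f g.
Proof.
by apply/dual_leP/dual_leP => fg x x0; move: (fg x x0); rewrite !dualDE lerD2r.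
Qed.

Fact dual_leUx f g h : dual_le (dual_join f g) h = dual_le f h && dual_le g h.
Proof.
rewrite -(dual_leD2r (- g)) addrAC subrr add0r dual_ppart_le.
by rewrite dual_leD2r -(dual_leD2r (g) 0) add0r subrK.
Qed.

Fact dual_lexI f g h : dual_le h (dual_meet f g) = dual_le h f && dual_le h g.
Proof.
have -> : dual_le h (dual_meet f g) = dual_le (dual_ppart (f - g)) (f - h).
  rewrite -(dual_leD2r (dual_ppart (f - g) - h)).
  by rewrite /dual_meet addrC subrK addrA subrK.
rewrite dual_ppart_le andbC; congr (_ && _).
  by rewrite -(dual_leD2r h) add0r subrK.
have subr_dual_le u v : dual_le 0 (v - u) = dual_le u v.
  by rewrite -(dual_leD2r u) add0r subrK.
by rewrite -subr_dual_le opprB addrC addrA subrK subr_dual_le.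
Qed.

Fact dual_lerD2r f g h : dual_le f g -> dual_le (f + h) (g + h).
Proof. by rewrite dual_leD2r. Qed.

Fact dual_scaler_ge0 a f : 0 <= a -> dual_le 0 f -> dual_le 0 (a *: f).
Proof.
move=> a0 /dual_leP f0; apply/dual_leP => x x0.
by rewrite dualZE mulr_ge0// -(dual0E x) f0.
Qed.

Fact dual_ler_norm f g :
  dual_le (dual_join f (- f)) (dual_join g (- g)) -> `|f| <= `|g|.
Proof.
move=> fg.
have fmod h x : 0 [<=] x -> `|h x| <= dual_join h (- h) x.
  move=> x0; have := dual_lexx (dual_join h (- h)); rewrite dual_leUx.
  move=> /andP[/dual_leP h1 /dual_leP h2].
  by rewrite ler_norml h1// andbT lerNl -dualNE h2.
have modg x : 0 [<=] x -> dual_join g (- g) x <= `|g| * `|x|.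
  move=> x0; rewrite dualDE dual_ppartE// opprK dualNE -lerBrDl opprK.
  apply: rk_le => // y y0 yx; rewrite -lerBlDr dualDE -dualD -dualB.
  rewrite (le_trans (ler_norm _))// (le_trans (ler_dual _ _))// ler_wpM2l//.
  exact: bl_subr_norm_le.
apply: dual_norm_le => // x; rewrite {1}(ppart_subE x) dualB.
rewrite (le_trans (ler_normB _ _))//.
apply: (@le_trans _ _ (dual_join g (- g) (ppart x + ppart (- x)))).
  rewrite dualD; move/dual_leP : fg => fg.
  by rewrite lerD// (le_trans (fmod _ _ _)) ?fg ?ppart_ge0.
rewrite (le_trans (modg _ _)) ?bl_addr_ge0 ?ppart_ge0// ler_wpM2l//.
rewrite -(norm_modulus x) ge0_ler_norm ?bl_addr_ge0 ?ppart_ge0//.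
exact: ppart_add_le.
Qed.

HB.instance Definition _ := isBanachLattice.Build R (dual E)
  dual_lexx dual_le_anti dual_le_trans dual_leUx dual_lexI dual_lerD2r
  dual_scaler_ge0 dual_ler_norm.

End DualLattice.

Section Sequences.
Context {R : realType} {E : banachLatticeType R}.

Definition disjoint_seq (x : nat -> E) : Prop :=
  forall n k, n != k -> bl_meet (modulus (x n)) (modulus (x k)) = 0.

Definition weakly_null (x : nat -> E) : Prop :=
  forall f : dual E, f (x n) @[n --> \oo] --> (0 : R).

Definition weakstar_null (f : nat -> dual E) : Prop :=
  forall x : E, f n x @[n --> \oo] --> (0 : R).

Definition order_bounded (x : nat -> E) : Prop :=
  exists a b : E, forall n, a [<=] x n /\ x n [<=] b.

End Sequences.

Definition positive_schur (R : realType) (E : banachLatticeType R) : Prop :=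
  forall x : nat -> E, (forall n, 0 [<=] x n) -> weakly_null x ->
  x n @[n --> \oo] --> (0 : E).

Definition dual_positive_schur (R : realType) (E : banachLatticeType R) : Prop :=
  forall f : nat -> dual E, (forall n, 0 [<=] f n) -> weakstar_null f ->
  f n @[n --> \oo] --> (0 : dual E).

Definition multilinear (R : realType) n (E : 'I_n -> banachLatticeType R)
    (G : lmodType R) (A : (forall i, E i) -> G) : Prop :=
  forall (i : 'I_n) (x : forall j, E j), linear (fun t : E i => A (dfwith x i t)).

Section MultilinearOperators.
Context {R : realType} {n : nat} {E : 'I_n -> banachLatticeType R}.

Definition positive_multilinear (F : banachLatticeType R)
    (A : (forall i, E i) -> F) : Prop :=
  multilinear A /\ forall x, (forall i, 0 [<=] x i) -> 0 [<=] A x.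

Definition regular_multilinear (F : banachLatticeType R)
    (A : (forall i, E i) -> F) : Prop :=
  exists B C : (forall i, E i) -> F,
    [/\ positive_multilinear B, positive_multilinear C &
        forall x, A x = B x - C x].

Definition almost_dunford_pettis (G : completeNormedModType R)
    (A : (forall i, E i) -> G) : Prop :=
  multilinear A /\
  forall x : nat -> forall i, E i,
    (forall i, disjoint_seq (fun k => x k i)) ->
    (forall i, weakly_null (fun k => x k i)) ->
    A (x k) @[k --> \oo] --> (0 : G).

End MultilinearOperators.

Section AronBerner.
Context {R : realType}.

(* The junk value 0 is never met when extending a bounded multilinear operator,
   see aron_bernerE and theta_dualE below. *)
Definition to_dual (E : banachLatticeType R) (f : E -> R) : dual E :=
  if pselect (scalar f /\ continuous f) is left fP
  then Dual (proj1 fP) (proj2 fP) else 0.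

Lemma to_dualE (E : banachLatticeType R) (f : E -> R) (M : R) : scalar f ->
  (forall x, `|f x| <= M * `|x|) -> to_dual f =1 f.
Proof.
move=> lf fM; rewrite /to_dual; case: pselect => // -[]; split => //.
exact: scalar_bounded_continuous fM.
Qed.

Context {n : nat} {E : 'I_n -> banachLatticeType R}.
Implicit Types (B : (forall i, E i) -> R) (x : forall i, E i).

(* A form on E_1 x ... x E_i is encoded as a function of all the variables
   that does not depend on those of index > i; theta i u is the operator
   written with an overline and the exponent theta: it applies u to the form
   in the i-th variable, the other ones being fixed. *)
Definition theta (i : 'I_n) (u : dual (dual (E i))) B : (forall j, E j) -> R :=
  fun x => u (to_dual (fun t : E i => B (dfwith x i t))).

(* theta_1 (theta_2 (... (theta_n (y \o A)))) depends on no variable any more;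
   its value is read at 0. *)
Definition aron_berner_form (F : banachLatticeType R)
    (A : (forall i, E i) -> F) (u : forall i, dual (dual (E i))) (y : dual F) : R :=
  foldr (fun i => theta (u i)) (fun x => y (A x)) (enum 'I_n) (fun=> 0).

Definition aron_berner (F : banachLatticeType R) (A : (forall i, E i) -> F)
    (u : forall i, dual (dual (E i))) : dual (dual F) :=
  to_dual (aron_berner_form A u).

End AronBerner.

Section AronBernerWellDefined.
Context {R : realType} {n : nat} {E : 'I_n -> banachLatticeType R}.
Implicit Types (B : (forall i, E i) -> R) (x : forall i, E i).

Lemma dfwithC x (i j : 'I_n) (s : E i) (t : E j) : i != j ->
  dfwith (dfwith x i s) j t = dfwith (dfwith x j t) i s.
Proof.
move=> ij; apply/functional_extensionality_dep => k.
have [<-|ik] := eqVneq i k.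
  by rewrite dfwithout 1?eq_sym// !dfwithin.
have [<-|jk] := eqVneq j k; first by rewrite dfwithin dfwithout// dfwithin.
by rewrite !dfwithout.
Qed.

(* bounded_form k C B : B is linear in each of the first k variables, and
   bounded by C times the product of their norms. *)
Definition bounded_form (k : nat) (C : R) B : Prop :=
  [/\ 0 <= C, forall x, `|B x| <= C * \prod_(j < n | (j < k)%N) `|x j| &
      forall (i : 'I_n) x, (i < k)%N -> scalar (fun t : E i => B (dfwith x i t))].

Lemma bounded_form_slice (i : 'I_n) (C : R) B x (t : E i) :
  bounded_form i.+1 C B ->
  `|B (dfwith x i t)| <= C * (\prod_(j < n | (j < i)%N) `|x j|) * `|t|.
Proof.
move=> [C0 Bb _]; apply: (le_trans (Bb _)); rewrite -mulrA ler_wpM2l//.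
rewrite (bigD1 i) ?ltnSn//= dfwithin mulrC.
rewrite (eq_big (fun j : 'I_n => (j < i)%N) (fun j => `|x j|))//.
- by move=> j; rewrite ltnS ltn_neqAle andbC.
- by move=> j /andP[_ ji]; rewrite dfwithout// eq_sym.
Qed.

Lemma theta_dualE (i : 'I_n) (C : R) B x (t : E i) : bounded_form i.+1 C B ->
  to_dual (fun t : E i => B (dfwith x i t)) t = B (dfwith x i t).
Proof.
move=> Bb; have [_ _ lB] := Bb.
apply: (@to_dualE _ _ _ (C * (\prod_(j < n | (j < i)%N) `|x j|))).
  by apply: lB.
by move=> s; apply: bounded_form_slice.
Qed.

Lemma theta_linear (i : 'I_n) (u : dual (dual (E i))) (C C' C'' : R) B B' B'' a x x' x'' :
  bounded_form i.+1 C B -> bounded_form i.+1 C' B' -> bounded_form i.+1 C'' B'' ->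
  (forall t, B (dfwith x i t) = a * B' (dfwith x' i t) + B'' (dfwith x'' i t)) ->
  theta u B x = a * theta u B' x' + theta u B'' x''.
Proof.
move=> Bb B'b B''b BE; rewrite /theta -dual_linear; congr (u _); apply: dualP => t.
by rewrite dualDE dualZE !(theta_dualE _ _ Bb, theta_dualE _ _ B'b, theta_dualE _ _ B''b).
Qed.

Lemma bounded_form_theta (i : 'I_n) (u : dual (dual (E i))) (C : R) B :
  bounded_form i.+1 C B -> bounded_form i (`|u| * C) (theta u B).
Proof.
move=> Bb; have [C0 _ lB] := Bb; split; first by rewrite mulr_ge0.
  move=> x; rewrite -mulrA (le_trans (ler_dual _ _))// ler_wpM2l//.
  apply: dual_norm_le => [|t]; first by rewrite mulr_ge0// prodr_ge0.
  by rewrite (theta_dualE _ _ Bb) bounded_form_slice.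
move=> j x ji a s t; apply: (theta_linear _ Bb Bb Bb) => r.
have ne : j != i by apply: contraTneq ji => ->; rewrite ltnn.
by rewrite !(dfwithC _ _ _ ne) lB// ltnW.
Qed.

Let partial_form (u : forall i, dual (dual (E i))) k B :=
  foldr (fun i => theta (u i)) B (drop k (enum 'I_n)).

Lemma partial_formS (u : forall i, dual (dual (E i))) (i : 'I_n) B :
  partial_form u i B = theta (u i) (partial_form u i.+1 B).
Proof.
rewrite /partial_form (drop_nth i) ?size_enum_ord//=.
by rewrite nth_ord_enum.
Qed.

Lemma partial_formP (F : banachLatticeType R) (A : (forall i, E i) -> F)
    (u : forall i, dual (dual (E i))) (M : R) (k : nat) :
  multilinear A -> (forall x, `|A x| <= M * \prod_(i < n) `|x i|) -> (k <= n)%N ->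
  exists2 C : R, 0 <= C &
    (forall y : dual F,
       bounded_form k (C * `|y|) (partial_form u k (fun x => y (A x)))) /\
    (forall a (y z : dual F) x,
       partial_form u k (fun x => (a *: y + z : dual F) (A x)) x =
       a * partial_form u k (fun x => y (A x)) x +
       partial_form u k (fun x => z (A x)) x).
Proof.
move=> lA bA kn; rewrite -(subKn kn).
elim: (n - k)%N (leq_subr k n) => {k kn} [|d IH] dn.
  exists `|M| => //; rewrite subn0; split => [y|a y z x]; last first.
    by rewrite /partial_form drop_oversize ?size_enum_ord.
  rewrite /partial_form drop_oversize ?size_enum_ord//=; split.
  - by rewrite mulr_ge0.
  - move=> x; rewrite (le_trans (ler_dual _ _))// [`|M| * _]mulrC -mulrA ler_wpM2l//.
    rewrite (eq_bigl xpredT) => [|j]; last by rewrite ltn_ord.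
    rewrite (le_trans (bA x))// ler_wpM2r ?ler_norm// prodr_ge0//.
  - by move=> i x _ a s t; rewrite lA dual_linear.
have [C C0 [Cb Cl]] := IH (ltnW dn).
have kn : (n - d.+1 < n)%N by rewrite ltn_subrL/=; case: (n) dn.
pose i := Ordinal kn.
have iE : (n - d = i.+1)%N by rewrite /= subnSK.
rewrite iE in Cb Cl; exists (`|u i| * C); first by rewrite mulr_ge0.
have -> : (n - d.+1 = i)%N by [].
split=> [y|a y z x].
  by rewrite partial_formS -mulrA; apply: bounded_form_theta.
rewrite !partial_formS.
by apply: (theta_linear _ (Cb _) (Cb _) (Cb _)) => t; exact: Cl.
Qed.

Lemma aron_bernerE (F : banachLatticeType R) (A : (forall i, E i) -> F) (M : R)
    (u : forall i, dual (dual (E i))) (y : dual F) :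
  multilinear A -> (forall x, `|A x| <= M * \prod_(i < n) `|x i|) ->
  aron_berner A u y = aron_berner_form A u y.
Proof.
move=> lA bA; have [C C0 [Cb Cl]] := partial_formP u lA bA (leq0n n).
apply: (@to_dualE _ _ _ C) => [a {}y z|{}y].
  by have := Cl a y z (fun=> 0); rewrite /partial_form drop0.
have [_ + _] := Cb y; move=> /(_ (fun=> 0)); rewrite /partial_form drop0.
by rewrite big_pred0 ?mulr1.
Qed.

End AronBernerWellDefined.

(* Main.v *)
Require Import Defs.
From HB Require Import structures.
From mathcomp Require Import all_boot all_order all_algebra.
From mathcomp Require Import all_classical all_reals.
From mathcomp Require Import topology normedtype sequences.
From mathcomp Require Import ring lra.

Set Implicit Arguments.
Unset Strict Implicit.
Unset Printing Implicit Defensive.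

Import Order.TTheory GRing.Theory Num.Theory.
Import numFieldTopology.Exports numFieldNormedType.Exports.

Local Open Scope classical_set_scope.
Local Open Scope ring_scope.

(** Write [A = B - C] with [B], [C] positive and replace every [u k i] by its
    modulus: only positive operators and positive sequences are left. By
    [disjoint_test_cvg0], a disjoint sequence criterion of Dodds and Fremlin, a
    positive weak*-null sequence of functionals is norm null as soon as it is
    small on disjoint bounded positive sequences. Applied to the variables one
    at a time, it reduces the weak* convergence of the extensions to the fact
    that a positive form tends to zero along bounded sequences one of which is
    disjoint. There, positive Schur is used twice on the duals: disjoint bounded
    positive sequences are weakly null, and the slices of the form in another
    variable, being weakly null by induction, are norm null. Finally the
    hypothesis on [F^*] turns the weak* convergence in [F^**] into norm
    convergence, by definition or by the disjoint sequence criterion again. *)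

(** * Null sequences *)

Lemma squeeze_cvg0 (R : realType) (a b : nat -> R) :
  (forall n, 0 <= a n <= b n) -> b n @[n --> \oo] --> (0 : R) ->
  a n @[n --> \oo] --> (0 : R).
Proof.
move=> ab b0; apply: (@squeeze_cvgr _ _ _ _ (fun=> 0) b) => //.
  exact: nearW.
exact: cvg_cst.
Qed.

Lemma cvg0D (R : realType) (a b : nat -> R) :
  a n @[n --> \oo] --> (0 : R) -> b n @[n --> \oo] --> (0 : R) ->
  a n + b n @[n --> \oo] --> (0 : R).
Proof. by move=> a0 b0; rewrite -[X in _ --> X](addr0 0); apply: cvgD. Qed.

Lemma cvg0N (R : realType) (a : nat -> R) :
  a n @[n --> \oo] --> (0 : R) -> - a n @[n --> \oo] --> (0 : R).
Proof. by move=> a0; rewrite -[X in _ --> X]oppr0; apply: cvgN. Qed.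

Lemma cvg0M (R : realType) (c : R) (a : nat -> R) :
  a n @[n --> \oo] --> (0 : R) -> c * a n @[n --> \oo] --> (0 : R).
Proof. by move=> a0; rewrite -[X in _ --> X](mulr0 c); apply: cvgMr. Qed.

Lemma cvg0_norm (R : realType) (V : normedModType R) (a : nat -> V) :
  a n @[n --> \oo] --> (0 : V) -> `|a n| @[n --> \oo] --> (0 : R).
Proof. by move=> a0; rewrite -[X in _ --> X](@normr0 _ V); apply: cvg_norm. Qed.

(** * Banach lattices *)

Section LatticeFacts.
Context {R : realType} {E : banachLatticeType R}.
Implicit Types (u v w x y z : E) (a c : R).

Lemma bl_meetC x y : bl_meet x y = bl_meet y x.
Proof. by apply: bl_le_anti; rewrite !bl_lexI !bl_leIl !bl_leIr. Qed.

Lemma bl_meet_ge0 x y : 0 [<=] x -> 0 [<=] y -> 0 [<=] bl_meet x y.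
Proof. by move=> x0 y0; rewrite bl_lexI x0. Qed.

Lemma bl_meet_le x y u v : x [<=] u -> y [<=] v -> bl_meet x y [<=] bl_meet u v.
Proof.
move=> xu yv; rewrite bl_lexI (bl_trans (bl_leIl _ _) xu).
exact: bl_trans (bl_leIr _ _) yv.
Qed.

Lemma bl_meet_idl x y : x [<=] y -> bl_meet x y = x.
Proof. by move=> xy; apply: bl_le_anti; rewrite bl_leIl bl_lexI bl_lexx xy. Qed.

Lemma bl_ge0_anti x : 0 [<=] x -> x [<=] 0 -> x = 0.
Proof. by move=> x0 x0'; apply: bl_le_anti; rewrite x0 x0'. Qed.

(** By the Riesz decomposition property the left side splits into positive parts below [u] and [v];
    as their sum is below [y], so is each of them. *)
Lemma bl_meetDr y u v : 0 [<=] y -> 0 [<=] u -> 0 [<=] v ->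
  bl_meet y (u + v) [<=] bl_meet y u + bl_meet y v.
Proof.
move=> y0 u0 v0.
have w0 : 0 [<=] bl_meet y (u + v) by rewrite bl_meet_ge0// bl_addr_ge0.
have [w1 [w2 [wE [w10 w1u] [w20 w2v]]]] := riesz_decomp u0 v0 w0 (bl_leIr _ _).
have wy := bl_leIl y (u + v); rewrite wE in wy *.
apply: bl_leD; rewrite bl_lexI ?w1u ?w2v andbT; apply: bl_trans wy.
  by rewrite -[X in X [<=] _]addr0 bl_leD2l.
by rewrite -[X in X [<=] _]add0r bl_leD2r.
Qed.

Lemma disj_le x y u v : 0 [<=] x -> x [<=] u -> 0 [<=] y -> y [<=] v ->
  bl_meet u v = 0 -> bl_meet x y = 0.
Proof.
move=> x0 xu y0 yv uv0; apply: bl_ge0_anti; first exact: bl_meet_ge0.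
by rewrite -uv0 bl_meet_le.
Qed.

Lemma disjD x u v : 0 [<=] x -> 0 [<=] u -> 0 [<=] v ->
  bl_meet x u = 0 -> bl_meet x v = 0 -> bl_meet x (u + v) = 0.
Proof.
move=> x0 u0 v0 xu xv; apply: bl_ge0_anti.
  by rewrite bl_meet_ge0// bl_addr_ge0.
by have := bl_meetDr x0 u0 v0; rewrite xu xv addr0.
Qed.

Lemma bl_meetZ c x y : 0 < c -> bl_meet (c *: x) (c *: y) = c *: bl_meet x y.
Proof.
move=> c0; have ci0 : 0 <= c^-1 by rewrite invr_ge0 ltW.
apply: bl_le_anti; apply/andP; split.
  rewrite -[X in X [<=] _](@scalerKV _ _ c) ?gt_eqF// bl_scaler_le ?ltW// bl_lexI.
  by apply/andP; split; rewrite -[X in _ [<=] X](@scalerK _ _ c) ?gt_eqF// bl_scaler_le// (bl_leIl, bl_leIr).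
by rewrite bl_lexI !bl_scaler_le ?ltW// (bl_leIl, bl_leIr).
Qed.

(** Passing to the multiples by [c + 1], which is nonzero, covers the case [c = 0] as well. *)
Lemma disjZ c x y : 0 <= c -> 0 [<=] x -> 0 [<=] y -> bl_meet x y = 0 ->
  bl_meet x (c *: y) = 0.
Proof.
move=> c0 x0 y0 xy0; have c1 : 0 < c + 1 by rewrite ltr_wpDl.
apply: (@disj_le _ _ ((c + 1) *: x) ((c + 1) *: y)) => //.
- by rewrite scalerDl scale1r -[X in X [<=] _]add0r bl_leD2r bl_scaler_ge0.
- exact: bl_scaler_ge0.
- by rewrite scalerDl scale1r -[X in X [<=] _]addr0 bl_leD2l.
- by rewrite bl_meetZ// xy0 scaler0.
Qed.

Lemma ppart_le x y : x [<=] y -> ppart x [<=] ppart y.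
Proof. by move=> xy; rewrite bl_leUx ppart_ge0 (bl_trans xy)// ppart_ge. Qed.

Lemma ppart_le_modulus x : ppart x [<=] modulus x.
Proof. by rewrite bl_leUx modulus_ge modulus_ge0. Qed.

Lemma ppartN_le_modulus x : ppart (- x) [<=] modulus x.
Proof. by rewrite -modulusN ppart_le_modulus. Qed.

Lemma modulus_le_ppart x : modulus x [<=] ppart x + ppart (- x).
Proof.
apply: modulus_le.
  by rewrite -[X in X [<=] _]addr0 bl_leD ?ppart_ge ?ppart_ge0.
by rewrite -[X in X [<=] _]add0r bl_leD ?ppart_ge ?ppart_ge0.
Qed.

Lemma modulusD x y : modulus (x + y) [<=] modulus x + modulus y.
Proof.
by apply: modulus_le; rewrite ?opprD bl_leD ?modulus_ge ?modulus_geN.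
Qed.

(** With [w] the meet, [ppart x - w] is still above both [x] and [0], so it dominates [ppart x], and
    [w [<=] 0]. *)
Lemma ppart_disj x : bl_meet (ppart x) (ppart (- x)) = 0.
Proof.
apply: bl_ge0_anti; first by rewrite bl_meet_ge0 ?ppart_ge0.
set w := bl_meet _ _.
have : ppart x [<=] ppart x - w.
  rewrite bl_leUx bl_subr_ge0 bl_leIl andbT {1}(ppart_subE x) bl_leD2l.
  by rewrite bl_leN2 bl_leIr.
by rewrite -bl_subr_ge0 addrAC subrr add0r -[X in X [<=] _]oppr0 bl_leN2.
Qed.

(** One positive part lies below the positive part of [z], the other below [c] times its negative
    part. Disjointness is recognised this way in [disjoint_test_cvg0]. *)
Lemma ppart_disj_scale c x y z : 0 <= c -> x [<=] z -> y [<=] - (c *: z) ->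
  bl_meet (ppart x) (ppart y) = 0.
Proof.
move=> c0 xz yz; apply: (@disj_le _ _ (ppart z) (c *: ppart (- z))) => //.
- exact: ppart_ge0.
- exact: ppart_le.
- exact: ppart_ge0.
- rewrite bl_leUx bl_scaler_ge0 ?ppart_ge0// andbT (bl_trans yz)// -scalerN.
  by rewrite bl_scaler_le// ppart_ge.
- by rewrite disjZ ?ppart_ge0// ppart_disj.
Qed.

(** [ppart (- x)] lies below the modulus of [x - y n], so its norm is arbitrarily small and it
    vanishes. *)
Lemma cvg_ge0 (y : nat -> E) x : (\forall n \near \oo, 0 [<=] y n) ->
  y n @[n --> \oo] --> x -> 0 [<=] x.
Proof.
move=> y0 yx; suff xn : ppart (- x) = 0.
  by rewrite (ppart_subE x) xn subr0 ppart_ge0.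
apply/eqP; rewrite -normr_eq0; apply/eqP/le_anti; rewrite normr_ge0 andbT.
apply/ler_addgt0Pl => e e0; rewrite addr0.
have [n [yn nx]] : exists n, 0 [<=] y n /\ `|x - y n| <= e.
  have /cvgrPdist_le/(_ _ e0) h := yx.
  by near \oo => n; exists n; split; near: n.
apply: le_trans nx; rewrite -norm_modulus; apply: ge0_ler_norm; first exact: ppart_ge0.
rewrite bl_leUx modulus_ge0 andbT (bl_trans _ (modulus_geN _))// opprB.
by rewrite -[X in X [<=] _]add0r bl_leD2r.
Unshelve. all: by end_near. Qed.

(** The series of the scaled vectors converges absolutely; its sum dominates each term because the
    terms are positive and the cone is closed. *)
Lemma dominating_sum (x : nat -> E) : (forall n, 0 [<=] x n) ->
  (forall n, `|x n| <= 1) ->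
  exists z : E, forall n, (2^-1 ^+ n : R) *: x n [<=] z.
Proof.
move=> x0 x1; pose v n := (2^-1 ^+ n : R) *: x n.
have v0 n : 0 [<=] v n by rewrite bl_scaler_ge0// exprn_ge0// invr_ge0.
have cv : cvgn (series v).
  apply: normed_cvg; apply: (@series_le_cvg _ _ (geometric 1 (2^-1 : R))) => [n|n|n|].
  - exact: normr_ge0.
  - by rewrite /geometric/= mulr_ge0// exprn_ge0// invr_ge0.
  - rewrite /geometric/= mul1r normrZ ger0_norm ?exprn_ge0 ?invr_ge0//.
    by rewrite -[leRHS]mulr1 ler_wpM2l// exprn_ge0// invr_ge0.
  - apply: is_cvg_geometric_series.
    by rewrite ger0_norm ?invr_ge0// invf_lt1 ?ltr1n.
have nd n m : (n < m)%N -> v n [<=] series v m.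
  elim: m => // m IH; rewrite ltnS leq_eqVlt seriesSr => /orP[/eqP->|/IH nm].
    rewrite -[X in X [<=] _]add0r bl_leD2r /series/=.
    by elim/big_rec: _ => [|i y _ y0]; rewrite ?bl_lexx// bl_addr_ge0.
  by rewrite -[X in X [<=] _]addr0 bl_leD.
exists (limn (series v)) => n; rewrite -bl_subr_ge0.
apply: (@cvg_ge0 (fun m => series v m - v n)); last by apply: cvgB => //; exact: cvg_cst.
by exists n.+1 => // m /= nm; rewrite bl_subr_ge0 nd.
Qed.

End LatticeFacts.

(** * Positive functionals and disjoint sequences *)

Section PositiveFunctionals.
Context {R : realType} {E : banachLatticeType R}.
Implicit Types (f g : dual E) (u v x y z : E).

Lemma dual_ge0P f : (0 [<=] f) <-> (forall x, 0 [<=] x -> 0 <= f x).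
Proof. by split => [/dual_leP|] f0; [exact: f0|apply/dual_leP]. Qed.

Lemma dual_ge0 f x : 0 [<=] f -> 0 [<=] x -> 0 <= f x.
Proof. by move=> /dual_ge0P; exact. Qed.

Lemma dual_le_ge0 f g x : f [<=] g -> 0 [<=] x -> f x <= g x.
Proof. by move=> /dual_leP; exact. Qed.

Lemma dual_homo f x y : 0 [<=] f -> x [<=] y -> f x <= f y.
Proof.
by move=> f0 xy; rewrite -subr_ge0 -dualB dual_ge0// bl_subr_ge0.
Qed.

Lemma dual_modulus f x : 0 [<=] f -> `|f x| <= f (modulus x).
Proof.
move=> f0; rewrite ler_norml lerNl -dualN.
by rewrite !dual_homo// ?modulus_ge ?modulus_geN.
Qed.

(** [q] is extended by [q (ppart x) - q (ppart (- x))]; domination by [f] makes the extension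
    bounded. *)
Lemma cone_functional (f : dual E) (q : E -> R) : 0 [<=] f ->
  (forall x y, 0 [<=] x -> 0 [<=] y -> q (x + y) = q x + q y) ->
  (forall a x, 0 <= a -> 0 [<=] x -> q (a *: x) = a * q x) ->
  (forall x, 0 [<=] x -> 0 <= q x <= f x) ->
  exists g : dual E, forall x, 0 [<=] x -> g x = q x.
Proof.
move=> f0 qD qZ qf.
have qbound x : `|q (ppart x) - q (ppart (- x))| <= (`|f| + `|f|) * `|x|.
  have qn y : `|q (ppart y)| <= `|f| * `|y|.
    have /andP[q0 qfy] := qf _ (ppart_ge0 y); rewrite ger0_norm//.
    rewrite (le_trans qfy)// (le_trans (ler_norm _))// (le_trans (ler_dual _ _))//.
    by rewrite ler_wpM2l// norm_ppart.
  rewrite (le_trans (ler_normB _ _))// mulrDl lerD//.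
  by rewrite -[X in _ <= _ * X]normrN.
exists (dual_of_bound (cone_extend qD qZ) qbound) => x x0 /=.
rewrite ppart_id// [ppart (- x)]bl_joinC bl_join_idl; last by rewrite -[X in _ [<=] X]oppr0 bl_leN2.
by have := qZ 0 0 (lexx 0) (bl_lexx _); rewrite scale0r mul0r => ->; rewrite subr0.
Qed.

Definition disj_cone (V : set E) : set E :=
  [set u | 0 [<=] u /\ forall v, V v -> bl_meet u v = 0].

(** For positive [f] and [V] this is the least positive extension, evaluated at [y >= 0], of the
    restriction of [f] to the vectors disjoint from [V]: a vector of [disj_cone V] below [y] equals
    its meet with [y]. *)
Definition component f (V : set E) y : R :=
  sup [set f (bl_meet y u) | u in disj_cone V].

Section Component.
Variables (f : dual E) (V : set E).
Hypotheses (f0 : 0 [<=] f) (V0 : forall v, V v -> 0 [<=] v).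

Lemma disj_cone0 : disj_cone V 0.
Proof. by split=> [|v Vv]; rewrite ?bl_lexx// bl_meet_idl// V0. Qed.

Lemma disj_coneD u v : disj_cone V u -> disj_cone V v -> disj_cone V (u + v).
Proof.
move=> [u0 uV] [v0 vV]; split => [|w Vw]; first exact: bl_addr_ge0.
by rewrite bl_meetC; apply: disjD => //; [exact: V0|rewrite bl_meetC uV|rewrite bl_meetC vV].
Qed.

Lemma disj_coneZ a u : 0 <= a -> disj_cone V u -> disj_cone V (a *: u).
Proof.
move=> a0 [u0 uV]; split => [|w Vw]; first exact: bl_scaler_ge0.
by rewrite bl_meetC; apply: disjZ => //; [exact: V0|rewrite bl_meetC uV].
Qed.

Lemma has_sup_component y : 0 [<=] y ->
  has_sup [set f (bl_meet y u) | u in disj_cone V].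
Proof.
move=> y0; split; first by exists (f (bl_meet y 0)), 0 => //; exact: disj_cone0.
by exists (f y) => _ [u _ <-]; rewrite dual_homo// bl_leIl.
Qed.

Lemma component_ub y u : 0 [<=] y -> disj_cone V u ->
  f (bl_meet y u) <= component f V y.
Proof.
move=> y0 Vu; apply: (sup_upper_bound (has_sup_component y0)).
by exists u.
Qed.

Lemma component_le y (M : R) : 0 [<=] y ->
  (forall u, disj_cone V u -> f (bl_meet y u) <= M) -> component f V y <= M.
Proof.
move=> y0 fM; apply: ge_sup; first by case: (has_sup_component y0).
by move=> _ [u Vu <-]; exact: fM.
Qed.

Lemma component_ge0 y : 0 [<=] y -> 0 <= component f V y.
Proof.
move=> y0; apply: le_trans (component_ub y0 disj_cone0).
by rewrite dual_ge0// bl_meet_ge0 ?bl_lexx.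
Qed.

Lemma component_le_dual y : 0 [<=] y -> component f V y <= f y.
Proof. by move=> y0; apply: component_le => // u _; rewrite dual_homo// bl_leIl. Qed.

(** One inequality is the subadditivity of meets; the other adds a test vector for [x] and one for
    [y], the cone being closed under sums. *)
Lemma componentD x y : 0 [<=] x -> 0 [<=] y ->
  component f V (x + y) = component f V x + component f V y.
Proof.
move=> x0 y0; have xy0 := bl_addr_ge0 x0 y0.
apply/eqP; rewrite eq_le; apply/andP; split.
  apply: component_le => // u Vu; have [u0 _] := Vu.
  apply: (@le_trans _ _ (f (bl_meet x u) + f (bl_meet y u))); last first.
    by rewrite lerD ?component_ub.
  by rewrite -dualD dual_homo// bl_meetC ![bl_meet _ u]bl_meetC bl_meetDr.
rewrite -lerBrDr; apply: component_le => // u Vu.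
rewrite lerBrDr -lerBrDl; apply: component_le => // v Vv.
rewrite lerBrDl -dualD (le_trans _ (component_ub xy0 (disj_coneD Vu Vv)))//.
by rewrite dual_homo// bl_lexI !bl_leD ?bl_leIl ?bl_leIr.
Qed.

Lemma componentZ a x : 0 <= a -> 0 [<=] x ->
  component f V (a *: x) = a * component f V x.
Proof.
have Zle b y : 0 < b -> 0 [<=] y -> b * component f V y <= component f V (b *: y).
  move=> b0 y0; rewrite -ler_pdivlMl//; apply: component_le => // u Vu.
  rewrite ler_pdivlMl// -dualZ -bl_meetZ// component_ub ?bl_scaler_ge0 ?ltW//.
  by apply: disj_coneZ => //; exact: ltW.
rewrite le_eqVlt => /predU1P[<-|a0] x0.
  apply/eqP; rewrite scale0r mul0r eq_le component_ge0 ?bl_lexx// andbT.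
  by rewrite (le_trans (component_le_dual (bl_lexx _)))// dual0.
apply/eqP; rewrite eq_le Zle// andbT -ler_pdivrMl//.
have := Zle a^-1 (a *: x); rewrite scalerK ?gt_eqF//; apply.
  by rewrite invr_gt0.
exact: bl_scaler_ge0 (ltW a0) x0.
Qed.

Lemma component_functional :
  exists g : dual E, forall y, 0 [<=] y -> g y = component f V y.
Proof.
apply: (cone_functional f0 componentD componentZ) => y y0.
by rewrite component_ge0// component_le_dual.
Qed.

Lemma component_id u : disj_cone V u -> component f V u = f u.
Proof.
move=> Vu; have [u0 _] := Vu; apply: le_anti; rewrite component_le_dual//.
by rewrite -{1}(bl_meet_idl (bl_lexx u)) component_ub.
Qed.

Lemma component_eq0 v : V v -> component f V v = 0.
Proof.
move=> Vv; apply: le_anti; rewrite component_ge0 ?V0// andbT.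
apply: component_le => [|u [u0 /(_ _ Vv)]]; first exact: V0.
by rewrite bl_meetC => ->; rewrite dual0.
Qed.

End Component.

(** Fewer vectors to be disjoint from leave a larger cone of test vectors. *)
Lemma component_anti f (V W : set E) y : 0 [<=] f ->
  (forall v, V v -> 0 [<=] v) -> W `<=` V -> 0 [<=] y ->
  component f V y <= component f W y.
Proof.
move=> f0 V0 WV y0; apply: (component_le f0 V0 y0) => u [u0 uV].
by apply: component_ub => // [v /WV /V0//|]; split => // v /WV; exact: uV.
Qed.

(* The component of f on the vectors disjoint from every ppart (- x n) agrees
   with f on ppart (x n), so that testing x against it isolates f (ppart x). *)
Lemma disjoint_weakly_null_ppart f (x : nat -> E) : 0 [<=] f ->
  disjoint_seq x -> weakly_null x -> f (ppart (x n)) @[n --> \oo] --> (0 : R).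
Proof.
move=> f0 dx wx; pose V := range (fun n => ppart (- x n)).
have V0 v : V v -> 0 [<=] v by move=> [n _ <-]; exact: ppart_ge0.
have [g gE] := component_functional f0 V0.
suff -> : (fun n => f (ppart (x n))) = (fun n => g (x n)) by exact: wx.
apply/funext => n; rewrite [in RHS](ppart_subE (x n)) dualB !gE ?ppart_ge0//.
rewrite (component_eq0 f0 V0 (v := ppart (- x n))) ?subr0; last by exists n.
rewrite component_id//; split => [|_ [k _ <-]]; first exact: ppart_ge0.
have [->|nk] := eqVneq n k; first exact: ppart_disj.
apply: (disj_le (ppart_ge0 _) (ppart_le_modulus _) (ppart_ge0 _) (ppartN_le_modulus _)).
exact: dx.
Qed.

Lemma dual_ppart_decomp f : exists g h : dual E,
  [/\ 0 [<=] g, 0 [<=] h & f = g - h].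
Proof. by exists (ppart f), (ppart (- f)); split; rewrite ?ppart_ge0// -ppart_subE. Qed.

Lemma weakly_null_ge0 (x : nat -> E) :
  (forall f, 0 [<=] f -> f (x n) @[n --> \oo] --> (0 : R)) -> weakly_null x.
Proof.
move=> h f; have [g [k [g0 k0 ->]]] := dual_ppart_decomp f.
exact: cvg0D (h g g0) (cvg0N (h k k0)).
Qed.

Lemma disjoint_seqN (x : nat -> E) : disjoint_seq x -> disjoint_seq (fun n => - x n).
Proof. by move=> dx n k nk; rewrite !modulusN dx. Qed.

Lemma weakly_nullN (x : nat -> E) : weakly_null x -> weakly_null (fun n => - x n).
Proof.
move=> wx f; under eq_cvg do rewrite dualN.
exact: cvg0N (wx f).
Qed.

(** [disjoint_weakly_null_ppart] applies to [x] and to [- x], and the modulus lies below the sum of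
    the two positive parts. *)
Lemma disjoint_weakly_null_modulus (x : nat -> E) :
  disjoint_seq x -> weakly_null x -> weakly_null (fun n => modulus (x n)).
Proof.
move=> dx wx; apply: weakly_null_ge0 => f f0.
apply: (@squeeze_cvg0 _ _ (fun n => f (ppart (x n)) + f (ppart (- x n)))).
  move=> n; rewrite dual_ge0 ?modulus_ge0//= -dualD.
  by rewrite dual_homo// modulus_le_ppart.
apply: cvg0D; first exact: disjoint_weakly_null_ppart.
exact: (disjoint_weakly_null_ppart f0 (disjoint_seqN dx) (weakly_nullN wx)).
Qed.

End PositiveFunctionals.

(** * Disjoint sequences and norm convergence of positive functionals *)

Lemma cvg_diff (R : realType) (a : nat -> R) (M : R) :
  {homo a : n m / (n <= m)%N >-> n <= m} ->
  (forall n, a n <= M) -> a n.+1 - a n @[n --> \oo] --> (0 : R).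
Proof.
move=> a_nd aM; have ac : cvgn a.
  apply: nondecreasing_is_cvgn; first exact: a_nd.
  by exists M => _ [n _ <-].
rewrite -(subrr (limn a)); apply: cvgB => //.
by have := ac; rewrite -(cvg_shiftS a).
Qed.

Section DisjointSequences.
Context {R : realType} {E : banachLatticeType R}.
Implicit Types (f : dual E).

(* The components g n of f on the vectors disjoint from e k for all k >= n
   increase with n and are dominated by f, so their increments are weakly null;
   the n-th increment agrees with f at e n. *)
Lemma positive_schur_dual_disjoint (e : nat -> E) (M : R) :
  positive_schur (dual E) -> (forall n, 0 [<=] e n) -> disjoint_seq e ->
  (forall n, `|e n| <= M) -> weakly_null e.
Proof.
move=> psE e0 de eM; apply: weakly_null_ge0 => f f0.
pose V n := [set e k | k in [set k | (n <= k)%N]].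
have V0 n v : V n v -> 0 [<=] v by move=> [k _ <-].
have /choice[g gE] n := component_functional f0 (V0 n).
have gnd n m : (n <= m)%N -> g n [<=] g m.
  move=> nm; apply/dual_leP => y y0; rewrite !gE//.
  apply: component_anti => //; first exact: V0.
  by move=> _ [k /= mk <-]; exists k => //=; exact: leq_trans mk.
have gf n : g n [<=] f.
  apply/dual_leP => y y0; rewrite gE// component_le_dual//; exact: V0.
have h0 n : 0 [<=] g n.+1 - g n by rewrite bl_subr_ge0 gnd.
(* [e n] belongs to [V n], so [g n] kills it, and it is disjoint from [V n.+1], so [g n.+1] agrees
   with [f] there. *)
have hE n : (g n.+1 - g n) (e n) = f (e n).
  rewrite dualBE !gE// (component_eq0 f0 (V0 n) (v := e n)) ?subr0; last by exists n => //=.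
  rewrite component_id//; first exact: V0.
  split => // _ [k /= nk <-].
  by have := de n k; rewrite !modulus_id// => ->//; rewrite neq_ltn nk.
have hn : g n.+1 - g n @[n --> \oo] --> (0 : dual E).
  apply: psE => //; apply: weakly_null_ge0 => u u0.
  under eq_cvg do rewrite dualB.
  apply: (@cvg_diff _ (fun n => u (g n)) (u f)).
    by move=> n m nm; rewrite dual_homo// gnd.
  by move=> n; rewrite dual_homo.
apply: (@squeeze_cvg0 _ _ (fun n => `|g n.+1 - g n| * M)).
  move=> n; rewrite dual_ge0//= -hE (le_trans (ler_norm _))//.
  by rewrite (le_trans (ler_dual _ _))// ler_wpM2l.
by under eq_cvg do rewrite mulrC; apply: cvg0M; exact: cvg0_norm.
Qed.

(** Since [f] is positive, [|f x| <= f (modulus x)], so positive vectors suffice; the factor 2 makes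
    up for a supremum that may not be attained. *)
Lemma norming_ge0 f : 0 [<=] f ->
  exists x, [/\ 0 [<=] x, `|x| <= 1 & `|f| <= 2 * f x].
Proof.
move=> f0; have [->|fn0] := eqVneq `|f| 0.
  by exists 0; rewrite bl_lexx normr0 dual0 mulr0.
have fp : 0 < `|f| by rewrite lt_neqAle eq_sym fn0/=.
have : `|f| / 2 < `|f| by rewrite gtr_pMr// invf_lt1// ltr1n.
move=> /(sup_gt (proj1 (has_sup_dual_norm f)))[_ [x /= x1 <-] fx].
exists (modulus x); rewrite modulus_ge0 norm_modulus; split => //.
rewrite mulrC -ler_pdivrMr// (le_trans (ltW fx))//.
exact: dual_modulus.
Qed.

Lemma norm_cvg0_ge0 (f : nat -> dual E) : (forall n, 0 [<=] f n) ->
  (forall x : nat -> E, (forall n, 0 [<=] x n) -> (forall n, `|x n| <= 1) ->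
    f n (x n) @[n --> \oo] --> (0 : R)) ->
  f n @[n --> \oo] --> (0 : dual E).
Proof.
move=> f0 fx; have /choice[x xP] n := norming_ge0 (f0 n).
apply: norm_cvg0; apply: (@squeeze_cvg0 _ _ (fun n => 2 * f n (x n))).
  by move=> n; rewrite normr_ge0/=; have [] := xP n.
by apply: cvg0M; apply: fx => n; have [] := xP n.
Qed.

Lemma dual_cvg0_bounded (f : nat -> dual E) (x : nat -> E) (M : R) :
  f n @[n --> \oo] --> (0 : dual E) -> (forall n, `|x n| <= M) ->
  f n (x n) @[n --> \oo] --> (0 : R).
Proof.
move=> fn xM; apply: norm_cvg0.
apply: (@squeeze_cvg0 _ _ (fun n => `|f n| * M)).
  by move=> n; rewrite normr_ge0/= (le_trans (ler_dual _ _))// ler_wpM2l.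
by under eq_cvg do rewrite mulrC; apply: cvg0M; exact: cvg0_norm.
Qed.

(** [n <= s n] forces [s] to tend to infinity, which is all that a limit asks of an extraction. *)
Lemma cvg_subseq (T : topologicalType) (a : nat -> T) (s : nat -> nat) (l : T) :
  (forall n, (n <= s n)%N) -> a n @[n --> \oo] --> l ->
  a (s n) @[n --> \oo] --> l.
Proof.
move=> sn al; apply: cvg_comp al => A [N _ NA].
by exists N => // n /= Nn; apply: NA => /=; exact: leq_trans (sn n).
Qed.

(* Disjointification: along a subsequence s, the vectors
   (x (s k) - 4^k sum_(i < k) x (s i) - 2^-k z)^+, with z dominating all the
   2^-k x (s k), are disjoint, and f (s k) almost agrees on them with its value
   at x (s k). *)
Lemma disjoint_test_cvg0 (f : nat -> dual E) : (forall n, 0 [<=] f n) ->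
  weakstar_null f ->
  (forall (s : nat -> nat) (e : nat -> E), (forall n, (n <= s n)%N) ->
    (forall n, 0 [<=] e n) -> disjoint_seq e -> (forall n, `|e n| <= 1) ->
    f (s n) (e n) @[n --> \oo] --> (0 : R)) ->
  f n @[n --> \oo] --> (0 : dual E).
Proof.
move=> f0 wf fe; apply: norm_cvg0_ge0 => // x x0 x1.
apply/cvgr0Pnorm_lt => eps eps0; apply: contrapT => nfx.
have big N : exists2 n, (N <= n)%N & eps <= f n (x n).
  apply: contrapT => nN; apply: nfx; exists N => // n /= Nn.
  rewrite ger0_norm ?dual_ge0// ltNge; apply/negP => le; apply: nN.
  by exists n.
have eps4 : 0 < eps / 4 by rewrite divr_gt0.
(* The next index is a bad one, so far out that the functional is small on a large multiple of
   [p.2], the sum of the vectors chosen so far. *)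
have step (p : nat * E) : exists n, [/\ (p.1 <= n)%N, eps <= f n (x n) &
    f n ((4 ^+ p.1 : R) *: p.2) < eps / 4].
  have /cvgr0Pnorm_lt/(_ _ eps4)[N _ NP] := wf ((4 ^+ p.1 : R) *: p.2).
  have [n] := big (maxn N p.1); rewrite geq_max => /andP[Nn pn] fn.
  exists n; split => //; exact: le_lt_trans (ler_norm _) (NP _ Nn).
have [g gP] := choice step.
pose S := fix S k := if k is k'.+1 then S k' + x (g (k', S k')) else 0 : E.
pose s k := g (k, S k); pose y k := x (s k).
have sk k : (k <= s k)%N by have [] := gP (k, S k).
have [z zP] := dominating_sum (fun k => x0 (s k)) (fun k => x1 (s k)).
have z0 : 0 [<=] z by apply: bl_trans (zP 0); rewrite expr0 scale1r x0.
have S0 k : 0 [<=] S k by elim: k => [|k IH] /=; rewrite ?bl_lexx ?bl_addr_ge0.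
have yS k l : (k < l)%N -> y k [<=] S l.
  elim: l => // l IH; rewrite ltnS leq_eqVlt => /orP[/eqP->|/IH kl] /=.
    by rewrite -[X in X [<=] _]add0r bl_leD2r.
  by rewrite -[X in X [<=] _]addr0 bl_leD.
pose e k := ppart (y k - (4 ^+ k : R) *: S k - (2^-1 ^+ k : R) *: z).
have p4 k : 0 <= (4 ^+ k : R) by rewrite exprn_ge0.
have p2 k : 0 <= (2^-1 ^+ k : R) by rewrite exprn_ge0// invr_ge0.
have e0 k : 0 [<=] e k by exact: ppart_ge0.
have ey k : e k [<=] y k.
  rewrite bl_leUx x0 andbT !bl_subr_le -addrA -[X in X [<=] _]addr0 bl_leD2l.
  by rewrite bl_addr_ge0 ?bl_scaler_ge0.
have de : disjoint_seq e.
  suff H k l : (k < l)%N -> bl_meet (e k) (e l) = 0.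
    move=> k l; rewrite !modulus_id// neq_ltn => /orP[/H//|/H].
    by rewrite bl_meetC.
  (* The separating vector is [y k - 2^-(k+l) y l]: [z] dominates [2^-l y l], and [4^l S l]
     dominates [4^l y k]. *)
  move=> kl; apply: (@ppart_disj_scale _ _ (4 ^+ l) _ _
      (y k - (2^-1 ^+ k * 2^-1 ^+ l : R) *: y l)) => //.
    rewrite addrAC bl_subr_le -[X in X [<=] _]addr0 bl_leD ?bl_scaler_ge0//.
    rewrite bl_leD2l bl_leN2 -scalerA bl_scaler_le//; exact: zP.
  apply: (@bl_trans _ _ _ (y l - (4 ^+ l : R) *: S l)).
    rewrite -[X in _ [<=] X]addr0 bl_leD2l -[X in _ [<=] X]oppr0 bl_leN2.
    by rewrite bl_scaler_ge0.
  rewrite scalerBr opprB bl_leD ?bl_leN2 ?bl_scaler_le ?yS//.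
  rewrite scalerA -[X in X [<=] _]scale1r -bl_subr_ge0 -scalerBl bl_scaler_ge0 ?x0//.
  (* The weights 4 and 1/2 are matched so that this factor is at least 1 for [k < l]. *)
  have -> : (4 ^+ l * (2^-1 ^+ k * 2^-1 ^+ l) : R) = 2 ^+ (l - k).
    have -> : (4 : R) = 2 * 2 by rewrite -natrM.
    rewrite exprMn -[X in 2 ^+ X * _](subnK (ltnW kl)) -{2}(subnK (ltnW kl)).
    have h i : (2 ^+ i : R) != 0 by rewrite expf_neq0// pnatr_eq0.
    rewrite -[X in _ * (_ * _ ^+ X)](subnK (ltnW kl)) !exprD !exprVn.
    by field; rewrite !h.
  by rewrite subr_ge0 exprn_ege1// ler1n.
have := fe s e sk e0 de (fun k => le_trans (ge0_ler_norm (e0 k) (ey k)) (x1 _)).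
have fz := cvg_subseq sk (wf z).
(* For large [k] the value of [f (s k)] at [e k] is below [eps / 4], whereas it exceeds
   [eps - eps / 4 - eps / 4]. *)
move=> /cvgr0Pnorm_lt/(_ _ eps4) h1.
move/cvgr0Pnorm_lt/(_ _ eps4) : fz => h2.
near \oo => k.
have k1 : `|f (s k) (e k)| < eps / 4 by near: k.
have k2 : `|f (s k) z| < eps / 4 by near: k.
have [_ k3 k4] := gP (k, S k).
rewrite ger0_norm ?dual_ge0// in k1; rewrite ger0_norm ?dual_ge0// in k2.
have := dual_homo (f0 (s k)) (ppart_ge (y k - (4 ^+ k : R) *: S k - (2^-1 ^+ k : R) *: z)).
rewrite !dualB [f (s k) (2^-1 ^+ k *: z)]dualZ leNgt => /negP; apply.
have k5 : (2^-1 ^+ k : R) * f (s k) z <= f (s k) z.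
  rewrite -[leRHS]mul1r ler_wpM2r ?dual_ge0// exprn_ile1 ?invr_ge0//.
  by rewrite invf_le1// ler1n.
lra.
Unshelve. all: by end_near. Qed.

End DisjointSequences.

(** * Norming functionals and the bidual *)

Section HahnBanach.
Context {R : realType} {E : normedModType R}.
Implicit Types (p q : E -> R) (x y : E).

(** Homogeneity is asked as an inequality for [a > 0], a form that passes to infima;
    [sublinear_belowZ] recovers the equality. *)
Definition sublinear_below p q : Prop :=
  [/\ forall x y, q (x + y) <= q x + q y,
      forall a x, 0 < a -> q (a *: x) <= a * q x & forall x, q x <= p x].

Lemma sublinear_below_trans p p' q : (forall x, p x <= p' x) ->
  sublinear_below p q -> sublinear_below p' q.
Proof. by move=> pp' [qD qZ qp]; split => // x; exact: le_trans (pp' x). Qed.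

(** [0 <= q 0 <= q (- x) + q x] and [q (- x) <= |x|]. The bound keeps infima over chains of such
    functionals finite. *)
Lemma sublinear_below_lb q x : sublinear_below Num.norm q -> - `|x| <= q x.
Proof.
move=> [qD _ qn]; have q0 : 0 <= q 0 by have := qD 0 0; rewrite addr0 lerDl.
rewrite lerNl -normrN -subr_ge0 opprK (le_trans _ (_ : q (- x) + q x <= _)) ?lerD//.
by rewrite (le_trans q0)// -(addNr x) qD.
Qed.

Lemma sublinear_below0 q : sublinear_below Num.norm q -> q 0 = 0.
Proof.
move=> qn; apply: le_anti; have := sublinear_below_lb 0 qn.
by have [_ _ /(_ 0)] := qn; rewrite normr0 oppr0 => -> ->.
Qed.

Lemma sublinear_belowZ q a x : sublinear_below Num.norm q -> 0 <= a ->
  q (a *: x) = a * q x.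
Proof.
move=> qn; rewrite le_eqVlt => /predU1P[<-|a0].
  by rewrite scale0r mul0r sublinear_below0.
have [_ qZ _] := qn; apply: le_anti; rewrite qZ//= -ler_pdivlMl//.
by rewrite -{1}(scalerK (lt0r_neq0 a0) x) qZ// invr_gt0.
Qed.

(** For [q] sublinear and below the norm, this is sublinear in [x], below [q] by [s = 0], and at
    most [- q y] at [- y] by [s = 1]. *)
Definition slope q y x : R := inf [set q (x + s *: y) - s * q y | s in [set s | 0 <= s]].

Lemma slope_has_inf q y x : sublinear_below Num.norm q ->
  has_inf [set q (x + s *: y) - s * q y | s in [set s | 0 <= s]].
Proof.
move=> qn; split; first by exists (q (x + 0 *: y) - 0 * q y), 0 => /=.
exists (- q (- x)) => _ [s /= s0 <-]; have [qD _ _] := qn.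
rewrite lerBrDr -(sublinear_belowZ _ qn s0) addrC lerBlDr addrC.
by rewrite (le_trans _ (qD _ _))// addrA addNr add0r.
Qed.

Lemma slope_le q y x s : sublinear_below Num.norm q -> 0 <= s ->
  slope q y x <= q (x + s *: y) - s * q y.
Proof.
move=> qn s0; apply: inf_lbound; first exact: (proj2 (slope_has_inf y x qn)).
by exists s.
Qed.

Lemma slope_ge q y x (M : R) : sublinear_below Num.norm q ->
  (forall s, 0 <= s -> M <= q (x + s *: y) - s * q y) -> M <= slope q y x.
Proof.
move=> qn h; apply: lb_le_inf; first exact: (proj1 (slope_has_inf y x qn)).
by move=> _ [s /= s0 <-]; exact: h.
Qed.

Lemma slope_sublinear q y : sublinear_below Num.norm q ->
  sublinear_below q (slope q y).
Proof.
move=> qn; have [qD qZ _] := qn; split => [x x'|a x a0|x].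
- rewrite -lerBlDr; apply: slope_ge => // s s0; rewrite lerBlDl -lerBlDr.
  apply: slope_ge => // t t0; rewrite lerBlDl.
  apply: le_trans (slope_le y (x + x') qn (addr_ge0 s0 t0)) _.
  by rewrite addrACA -opprD -mulrDl lerD2r scalerDl addrACA qD.
- rewrite -ler_pdivrMl//; apply: slope_ge => // s s0; rewrite ler_pdivrMl//.
  apply: le_trans (slope_le y (a *: x) qn (mulr_ge0 (ltW a0) s0)) _.
  by rewrite mulrBr mulrA lerD2r -scalerA -scalerDr qZ.
- by rewrite (le_trans (slope_le y x qn (lexx 0)))// scale0r addr0 mul0r subr0.
Qed.

(** Zorn's lemma applies because the pointwise infimum of a chain is again sublinear. *)
Lemma minimal_sublinear p : sublinear_below Num.norm p ->
  exists2 q, sublinear_below p q & forall q', sublinear_below q q' -> q' = q.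
Proof.
move=> pn; have [_ _ pnorm] := pn.
pose T := {q : E -> R | sublinear_below p q}.
(* The order is reversed, so that maximal elements are minimal functionals. *)
pose le (s t : T) := `[< forall x, sval t x <= sval s x >].
have norm_of (t : T) : sublinear_below Num.norm (sval t).
  exact: sublinear_below_trans (svalP t).
have pp : sublinear_below p p by case: pn.
have T_eq (s t : T) : sval s = sval t -> s = t.
  case: s t => [s sP] [t tP] /= st; subst t; congr exist; exact: Prop_irrelevance.
have chain (A : set T) : total_on A le -> exists t, forall s, A s -> le s t.
  move=> totA; have [->|/set0P[s0 As0]] := eqVneq A set0.
    by exists (exist _ p pp).
  pose val_at x := [set sval s x | s in A].
  have ne x : val_at x !=set0 by exists (sval s0 x), s0.
  have lb x : has_lbound (val_at x).
    by exists (- `|x|) => _ [s _ <-]; exact: sublinear_below_lb.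
  pose i x := inf (val_at x).
  have i_le s x : A s -> i x <= sval s x by move=> As; apply: inf_lbound => //; exists s.
  have iP : sublinear_below p i.
    split => [x y|a x a0|x].
    - rewrite -lerBlDr; apply: lb_le_inf => // _ [s As <-]; rewrite lerBlDl -lerBlDr.
      apply: lb_le_inf => // _ [t At <-]; rewrite lerBlDl.
      (* Of two members of the chain, the smaller one serves for both [x] and [y]. *)
      have [/asboolP st|/asboolP ts] := totA _ _ As At.
        have [tD _ _] := svalP t; apply: le_trans (i_le _ _ At) (le_trans (tD _ _) _).
        by rewrite lerD2r.
      have [sD _ _] := svalP s; apply: le_trans (i_le _ _ As) (le_trans (sD _ _) _).
      by rewrite lerD2l.
    - rewrite -ler_pdivrMl//; apply: lb_le_inf => // _ [s As <-]; rewrite ler_pdivrMl//.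
      by have [_ sZ _] := svalP s; apply: le_trans (i_le _ _ As) (sZ _ _ a0).
    - by have [_ _ sp] := svalP s0; apply: le_trans (i_le _ _ As0) (sp _).
  by exists (exist _ i iP) => s As; apply/asboolP => x; exact: i_le.
have [|r s t /asboolP rs /asboolP st|s t /asboolP st /asboolP ts|q qmax] := Zorn _ _ _ chain.
- by move=> t; apply/asboolP.
- by apply/asboolP => x; exact: le_trans (st x) (rs x).
- by apply: T_eq; apply/funext => x; apply: le_anti; rewrite st ts.
exists (sval q); first exact: svalP.
move=> q' qq'; have q'P : sublinear_below p q'.
  by apply: sublinear_below_trans qq'; have [_ _] := svalP q.
have <- : exist _ q' q'P = q by apply: qmax; apply/asboolP; case: qq'.
by [].
Qed.

(* A minimal sublinear functional coincides with its slopes in all directions,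
   hence is additive. *)
Lemma sublinear_dominates_linear p : sublinear_below Num.norm p ->
  exists2 f : E -> R, scalar f & forall x, f x <= p x.
Proof.
move=> pn; have [q qp qmin] := minimal_sublinear pn.
have qn : sublinear_below Num.norm q.
  by apply: sublinear_below_trans qp; have [_ _] := pn.
exists q; last by case: qp.
have [qsub _ _] := qn.
have qD x y : q (x + y) = q x + q y.
  apply: le_anti; rewrite qsub/= -lerBrDr.
  rewrite -[in leLHS](qmin _ (slope_sublinear y qn)).
  by have := slope_le y x qn ler01; rewrite scale1r mul1r.
have qN x : q (- x) = - q x.
  by apply/eqP; rewrite -addr_eq0 -qD addNr sublinear_below0.
move=> a x y; rewrite qD; congr (_ + _).
have [a0|/ltW a0] := leP 0 a; first exact: sublinear_belowZ.
rewrite -oppr_ge0 in a0; have := sublinear_belowZ x qn a0.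
by rewrite scaleNr qN mulNr => /oppr_inj.
Qed.

(** The functional is taken below the slope of the norm in the direction [x], whose value at [- x]
    is at most [- |x|]. *)
Lemma hahn_banach_norming x : exists f : E -> R,
  [/\ scalar f, forall y, `|f y| <= `|y| & f x = `|x|].
Proof.
have nn : sublinear_below Num.norm (Num.norm : E -> R).
  split => // [y z|a y a0]; first exact: ler_normD.
  by rewrite normrZ gtr0_norm.
have sn : sublinear_below Num.norm (slope Num.norm x) := slope_sublinear x nn.
have [f lf fs] := sublinear_dominates_linear sn.
have fn y : f y <= `|y| by have [_ _ h] := sn; exact: le_trans (fs y) (h y).
have f0 : f 0 = 0.
  by have /eqP := lf 1 0 0; rewrite scaler0 addr0 mul1r -subr_eq0 opprD addNKr oppr_eq0 => /eqP.
have fN y : f (- y) = - f y.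
  by have := lf (-1) y 0; rewrite f0 !addr0 scaleN1r mulN1r.
exists f; split => // [y|].
  by rewrite ler_norml fn lerNl -fN -[leRHS]normrN fn.
apply: le_anti; rewrite fn/= -lerN2 -fN.
apply: le_trans (fs _) (le_trans (slope_le x (- x) nn ler01) _).
by rewrite scale1r addNr normr0 mul1r add0r.
Qed.

End HahnBanach.

(** * The canonical embedding and uniform boundedness *)

Section Bidual.
Context {R : realType} {E : banachLatticeType R}.
Implicit Types (f : dual E) (x y : E).

Lemma eval_linear x : scalar (fun f : dual E => f x).
Proof. by []. Qed.

Lemma eval_bound x (f : dual E) : `|f x| <= `|x| * `|f|.
Proof. by rewrite mulrC ler_dual. Qed.

Definition embed x : dual (dual E) := dual_of_bound (eval_linear x) (eval_bound x).

(** A norming functional at [x] gives the lower bound. *)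
Lemma norm_embed x : `|embed x| = `|x|.
Proof.
apply: le_anti; apply/andP; split.
  by apply: dual_norm_le => // f; exact: eval_bound.
have [f [lf fn fx]] := hahn_banach_norming x.
have fb y : `|f y| <= 1 * `|y| by rewrite mul1r.
have := ler_dual (embed x) (dual_of_bound lf fb); rewrite /= fx normr_id.
move=> /le_trans; apply; rewrite -[leRHS]mulr1 ler_wpM2l//.
exact: dual_norm_le.
Qed.

Lemma bounded_fun_ex (V : normedModType R) (x : nat -> V) :
  bounded_fun x -> exists M : R, forall n, `|x n| <= M.
Proof.
move=> xb; near +oo_R => M; exists M => n.
suff : globally setT [set n | `|x n| <= M] by apply.
by near: M.
Unshelve. all: by end_near. Qed.

(** Uniform boundedness principle, the pointwise bounds coming from convergence. *)
Lemma weakstar_null_bounded (f : nat -> dual E) : weakstar_null f ->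
  exists M : R, forall n, `|f n| <= M.
Proof.
move=> wf; pose F : set (E -> R^o) := range (fun n => f n : E -> R^o).
have FB g : F g -> bounded_fun_norm g /\ linear g.
  move=> [n _ <-]; split; last exact: (@dual_linear _ _ (f n)).
  move=> r; exists (`|f n| * r) => x xr.
  by rewrite (le_trans (ler_dual (f n) x))// ler_wpM2l.
have FP : pointwise_bounded F.
  move=> x; have cx : cvgn (fun n => f n x : R^o) by apply/cvg_ex; exists 0; exact: wf.
  have [M xM] := bounded_fun_ex (cvg_seq_bounded cx).
  by exists M => _ [n _ <-]; exact: xM.
have [M FM] := Banach_Steinhauss FB FP 1.
exists M => n; apply: ge_sup; first by case: (has_sup_dual_norm (f n)).
by move=> _ [x /= x1 <-]; apply: FM => //; exists n.
Qed.

End Bidual.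

Section WeaklyNull.
Context {R : realType} {E : banachLatticeType R}.

Lemma weakly_null_embed (x : nat -> E) : weakly_null x ->
  weakstar_null (fun n => embed (x n)).
Proof. by move=> wx f; exact: wx. Qed.

(** The canonical embedding turns weak nullity into weak* nullity and preserves norms. *)
Lemma weakly_null_bounded (x : nat -> E) : weakly_null x ->
  exists M : R, forall n, `|x n| <= M.
Proof.
move=> wx; have [M xM] := weakstar_null_bounded (weakly_null_embed wx).
by exists M => n; rewrite -norm_embed.
Qed.

Lemma weakly_null_weakstar (f : nat -> dual E) : weakly_null f -> weakstar_null f.
Proof. by move=> wf x; exact: (wf (embed x)). Qed.

End WeaklyNull.

Section BoundedSequences.
Context {R : realType} {E : banachLatticeType R}.

Lemma dual_bounded_cvg0 (f : nat -> dual E) (x : nat -> E) (M : R) :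
  (forall n, `|f n| <= M) -> x n @[n --> \oo] --> (0 : E) ->
  f n (x n) @[n --> \oo] --> (0 : R).
Proof.
move=> fM xn; apply: norm_cvg0.
apply: (@squeeze_cvg0 _ _ (fun n => M * `|x n|)).
  by move=> n; rewrite normr_ge0/= (le_trans (ler_dual _ _))// ler_wpM2r.
by apply: cvg0M; exact: cvg0_norm.
Qed.

Lemma weakstar_null_ge0 (f : nat -> dual E) :
  (forall x, 0 [<=] x -> f n x @[n --> \oo] --> (0 : R)) -> weakstar_null f.
Proof.
move=> h x; rewrite (ppart_subE x); under eq_cvg do rewrite dualB.
by apply: cvg0D; [|apply: cvg0N]; exact: h (ppart_ge0 _).
Qed.

End BoundedSequences.

(** * Changing one coordinate of a tuple *)

Section Dfwith.
Context {I : eqType} {T : I -> Type}.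
Implicit Types (x : forall i, T i).

Lemma dfwith_id x i : dfwith x i (x i) = x.
Proof.
apply/functional_extensionality_dep => j.
by have [<-|ij] := eqVneq i j; [rewrite dfwithin|rewrite dfwithout].
Qed.

Lemma dfwith_ind (P : forall i, T i -> Prop) x i (t : T i) :
  (forall j, j != i -> P j (x j)) -> P i t -> forall j, P j (dfwith x i t j).
Proof.
move=> Px Pt j; have [<-|ij] := eqVneq i j; first by rewrite dfwithin.
by rewrite dfwithout//; apply: Px; rewrite eq_sym.
Qed.

End Dfwith.

(** * Positive multilinear forms *)

Section Forms.
Context {R : realType} {n : nat} {E : 'I_n -> banachLatticeType R}.
Implicit Types (B : (forall i, E i) -> R) (x : forall i, E i) (S T : {set 'I_n}).

(* A bounded multilinear form in the variables of S, encoded as for theta by a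
   function of all the variables that only depends on those of S. *)
Definition mform S B : Prop :=
  [/\ exists2 C : R, 0 <= C & forall x, `|B x| <= C * \prod_(j in S) `|x j|,
      forall i x, i \in S -> scalar (fun t : E i => B (dfwith x i t)) &
      forall x y, (forall i, i \in S -> x i = y i) -> B x = B y].

Definition posform B : Prop := forall x, (forall i, 0 [<=] x i) -> 0 <= B x.

(** For an [mform] in a set of variables containing [i], [sliceE] rules out the default value [0] of
    [to_dual]. *)
Definition slice B x (i : 'I_n) : dual (E i) := to_dual (fun t : E i => B (dfwith x i t)).

Lemma dfwith_ge0 x (i : 'I_n) (t : E i) : (forall j, 0 [<=] x j) -> 0 [<=] t ->
  forall j, 0 [<=] dfwith x i t j.
Proof. by move=> x0 t0; apply: (@dfwith_ind _ _ (fun i (s : E i) => 0 [<=] s)). Qed.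

Lemma mform_slice_bound S B x (i : 'I_n) : mform S B -> i \in S ->
  exists C : R, (0 <= C /\ forall y, (forall j, j != i -> y j = x j) ->
    forall t : E i, `|B (dfwith y i t)| <= C * `|t|).
Proof.
move=> [[C C0 Bb] _ _] iS; exists (C * \prod_(j in S :\ i) `|x j|).
split=> [|y yx t]; first by rewrite mulr_ge0// prodr_ge0.
apply: (le_trans (Bb _)); rewrite -mulrA ler_wpM2l// (big_setD1 i)//= dfwithin mulrC.
rewrite (eq_bigr (fun j => `|x j|))// => j; rewrite in_setD1 => /andP[ji _].
by rewrite dfwithout 1?eq_sym// yx.
Qed.

Lemma sliceE S B x (i : 'I_n) (t : E i) : mform S B -> i \in S ->
  slice B x i t = B (dfwith x i t).
Proof.
move=> Bm iS; have [C [_ Cb]] := mform_slice_bound x Bm iS.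
apply: (@to_dualE _ _ _ C); first by have [_ lB _] := Bm; exact: lB.
by move=> s; apply: Cb.
Qed.

Lemma slice_ge0 S B x (i : 'I_n) : mform S B -> i \in S -> posform B ->
  (forall j, 0 [<=] x j) -> 0 [<=] slice B x i.
Proof.
move=> Bm iS B0 x0; apply/dual_ge0P => t t0.
by rewrite (sliceE _ _ Bm)// B0//; exact: dfwith_ge0.
Qed.

(** Forms and base points vary together, so that one statement gives linearity both in another
    variable and in the form. *)
Lemma theta_comb (i : 'I_n) (u : dual (dual (E i))) S S' S'' B B' B'' a x x' x'' :
  mform S B -> mform S' B' -> mform S'' B'' ->
  i \in S -> i \in S' -> i \in S'' ->
  (forall t, B (dfwith x i t) = a * B' (dfwith x' i t) + B'' (dfwith x'' i t)) ->
  theta u B x = a * theta u B' x' + theta u B'' x''.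
Proof.
move=> Bm Bm' Bm'' iS iS' iS'' BE.
rewrite /theta -dual_linear; congr (u _); apply: dualP => t.
rewrite dualDE dualZE.
by have := (sliceE x t Bm iS, sliceE x' t Bm' iS', sliceE x'' t Bm'' iS''); rewrite /slice => h; rewrite !h.
Qed.

Lemma mform_theta S B (i : 'I_n) (u : dual (dual (E i))) : mform S B -> i \in S ->
  mform (S :\ i) (theta u B).
Proof.
move=> Bm iS; have [[C C0 Bb] lB indB] := Bm; split.
- exists (`|u| * C) => [|x]; first by rewrite mulr_ge0.
  rewrite -mulrA (le_trans (ler_dual _ _))// ler_wpM2l//.
  apply: dual_norm_le => [|t]; first by rewrite mulr_ge0// prodr_ge0.
  have := sliceE x t Bm iS; rewrite /slice => ->; apply: (le_trans (Bb _)).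
  rewrite -mulrA ler_wpM2l// (big_setD1 i)//= dfwithin mulrC.
  rewrite (eq_bigr (fun j => `|x j|))// => j; rewrite in_setD1 => /andP[ji _].
  by rewrite dfwithout 1?eq_sym.
- move=> j x; rewrite in_setD1 => /andP[ji jS] a s t.
  apply: (theta_comb _ Bm Bm Bm) => // r.
  by rewrite !(dfwithC _ _ _ ji) lB.
- move=> x y xy; rewrite /theta; congr (u (to_dual _)); apply/funext => t.
  apply: indB => j jS; have [<-|ij] := eqVneq i j; first by rewrite !dfwithin.
  by rewrite !dfwithout// xy// in_setD1 eq_sym ij.
Qed.

Lemma posform_theta S B (i : 'I_n) (u : dual (dual (E i))) : mform S B -> i \in S ->
  posform B -> 0 [<=] u -> posform (theta u B).
Proof. by move=> Bm iS B0 u0 x x0; apply: dual_ge0 => //; exact: slice_ge0 Bm iS B0 x0. Qed.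

Definition remove S (l : seq 'I_n) : {set 'I_n} := foldr (fun i T => T :\ i) S l.

Lemma in_remove S (l : seq 'I_n) (i : 'I_n) :
  (i \in remove S l) = (i \notin l) && (i \in S).
Proof. by elim: l => //= j l IH; rewrite in_setD1 IH in_cons negb_or andbA. Qed.

Lemma mform_foldr_theta S B (u : forall i, dual (dual (E i))) (l : seq 'I_n) :
  mform S B -> uniq l -> {subset l <= S} ->
  mform (remove S l) (foldr (fun i => theta (u i)) B l).
Proof.
move=> Bm; elim: l => [//|i l IH] /= /andP[il ul] lS; apply: mform_theta.
  by apply: IH => // j jl; rewrite lS// in_cons jl orbT.
by rewrite in_remove il lS// mem_head.
Qed.

Lemma posform_foldr_theta S B (u : forall i, dual (dual (E i))) (l : seq 'I_n) :
  mform S B -> uniq l -> {subset l <= S} -> posform B -> (forall i, 0 [<=] u i) ->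
  posform (foldr (fun i => theta (u i)) B l).
Proof.
move=> Bm ul lS B0 u0; elim: l ul lS => [//|i l IH] /= /andP[il ul] lS.
have lS' : {subset l <= S} by move=> j jl; rewrite lS// in_cons jl orbT.
apply: (posform_theta (mform_foldr_theta u Bm ul lS')) => //; last exact: IH.
by rewrite in_remove il lS// mem_head.
Qed.

Hypothesis psE : forall i, positive_schur (dual (E i)).

Definition bounded_coord (x : nat -> forall i, E i) : Prop :=
  forall i, exists M : R, forall k, `|x k i| <= M.

Lemma bounded_coord_dfwith (x : nat -> forall i, E i) (i : 'I_n) (t : nat -> E i) (M : R) :
  bounded_coord x -> (forall k, `|t k| <= M) ->
  bounded_coord (fun k => dfwith (x k) i (t k)).
Proof.
move=> bx tM j; have [<-|ij] := eqVneq i j.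
  by exists M => k; rewrite dfwithin.
by have [N xN] := bx j; exists N => k; rewrite dfwithout.
Qed.

(* Induction on S: by the positive Schur property it suffices to see that the
   slices of B in a variable i != j are weakly null, and u evaluated at such a
   slice is the form theta u B, which has one variable less. *)
Lemma form_disjoint_cvg0 S B (j : 'I_n) (x : nat -> forall i, E i) :
  mform S B -> posform B -> j \in S -> (forall k i, 0 [<=] x k i) ->
  bounded_coord x -> disjoint_seq (fun k => x k j) ->
  B (x k) @[k --> \oo] --> (0 : R).
Proof.
move=> Bm B0 jS x0 bx dx.
have [c leS] := ubnP #|S|; elim: c => // c IH in S B Bm B0 jS leS *.
have [Sj|/finset.set0Pn[i]] := eqVneq (S :\ j) finset.set0.
  (* With [j] alone left, [B] is a single functional tested on a disjoint bounded sequence. *)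
  have -> : (fun k => B (x k)) = (fun k => slice B (fun=> 0) j (x k j)).
    apply/funext => k; rewrite (sliceE _ _ Bm)//.
    have [_ _ indB] := Bm; apply: indB => i iS; have [<-|ji] := eqVneq j i.
      by rewrite dfwithin.
    by have := finset.in_set0 i; rewrite -Sj in_setD1 iS eq_sym ji.
  have [M xM] := bx j; exact: (positive_schur_dual_disjoint (@psE j) _ dx xM).
rewrite in_setD1 => /andP[ij iS].
have s0 : slice B (x k) i @[k --> \oo] --> (0 : dual (E i)).
  apply: psE => [k|]; first exact: slice_ge0 Bm iS B0 _.
  apply: weakly_null_ge0 => u u0; apply: (IH (S :\ i) (theta u B)).
  - exact: mform_theta.
  - exact: posform_theta Bm iS B0 u0.
  - by rewrite in_setD1 eq_sym ij.
  - by rewrite -ltnS (leq_trans _ leS)// ltnS [in leqRHS](cardsD1 i) iS.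
have [M xM] := bx i; have := dual_cvg0_bounded s0 xM.
by under eq_cvg do rewrite (sliceE _ _ Bm)// dfwith_id.
Qed.

(* T is the set of variables in which x is not constant; it is emptied one
   variable at a time by disjoint_test_cvg0. *)
Lemma theta_weakstar_cvg0 S T B (i0 : 'I_n) (u : nat -> dual (dual (E i0)))
    (x : nat -> forall i, E i) :
  mform S B -> posform B -> i0 \in S -> T \subset S :\ i0 ->
  (forall k, 0 [<=] u k) -> weakstar_null u ->
  (forall k i, 0 [<=] x k i) -> bounded_coord x ->
  (forall i k, i \in S :\ i0 -> i \notin T -> x k i = x 0 i) ->
  theta (u k) B (x k) @[k --> \oo] --> (0 : R).
Proof.
move=> Bm B0 iS TS u0 wu x0 bx xT; have [M uM] := weakstar_null_bounded wu.
have um k := mform_theta (u k) Bm iS.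
have [c leT] := ubnP #|T|; elim: c => // c IH in T TS x x0 bx xT leT *.
have [T0|/finset.set0Pn[i iT]] := eqVneq T finset.set0.
  (* The base point is constant, so [u k] is evaluated at one fixed slice. *)
  have -> : (fun k => theta (u k) B (x k)) = (fun k => u k (slice B (x 0) i0)).
    apply/funext => k; have [_ _ ind] := um k; rewrite (ind _ (x 0))// => i iS0.
    by apply: xT; rewrite // T0 finset.in_set0.
  exact: wu.
have iS0 := fintype.subsetP TS _ iT.
pose phi k := slice (theta (u k) B) (x k) i.
have phiE k t : phi k t = theta (u k) B (dfwith (x k) i t) by exact: sliceE (um k) iS0.
(* Fixing the variable [i] removes it from [T], so the slices [phi k] are weak*-null by induction;
   disjoint test sequences remain. *)
have p0 : phi k @[k --> \oo] --> (0 : dual (E i)).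
  apply: disjoint_test_cvg0 => [k||s e sk e0 de e1].
  - by apply: slice_ge0 (um k) iS0 _ _ => //; exact: posform_theta Bm iS B0 _.
  - apply: weakstar_null_ge0 => t t0; under eq_cvg do rewrite phiE.
    apply: (IH (T :\ i)).
    + exact: fintype.subset_trans (subD1set _ _) TS.
    + by move=> k; exact: dfwith_ge0.
    + by apply: (bounded_coord_dfwith (M := `|t|)).
    + move=> j k jS; rewrite in_setD1 negb_and negbK.
      have [<-|ij] := eqVneq i j; first by rewrite !dfwithin.
      by rewrite /= !dfwithout// => jT; exact: xT.
    + by rewrite -ltnS (leq_trans _ leT)// ltnS [in leqRHS](cardsD1 i) iT.
  - under eq_cvg do rewrite phiE.
    (* As [e] is disjoint, the slices of [B] in the variable [i0] are weakly null by
       [form_disjoint_cvg0], hence norm null, while [u] is bounded. *)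
    pose y k := dfwith (x (s k)) i (e k).
    have y0 k : forall j, 0 [<=] y k j by exact: dfwith_ge0.
    apply: (dual_bounded_cvg0 (fun k => uM (s k))); rewrite -/(slice _ _ _).
    apply: (psE (x := fun k => slice B (y k) i0)) => [k|].
      exact: slice_ge0 Bm iS B0 _.
    apply: weakly_null_ge0 => v v0.
    apply: (@form_disjoint_cvg0 (S :\ i0) (theta v B) i) => //.
    + exact: mform_theta.
    + exact: posform_theta Bm iS B0 v0.
    + apply: (bounded_coord_dfwith (M := 1)) => // j.
      by have [N xN] := bx j; exists N => k.
    + by rewrite /y; under [X in disjoint_seq X]eq_fun do rewrite dfwithin.
have [N xN] := bx i; have := dual_cvg0_bounded p0 xN.
by under eq_cvg do rewrite phiE dfwith_id.
Qed.

(** Induction on [l]: the outermost [u k i] is bounded, so norm nullity of the slices in the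
    variable [i] suffices, and testing them on bounded positive vectors is the induction hypothesis
    at a modified [x]. The base case is [theta_weakstar_cvg0]. *)
Lemma foldr_theta_cvg0 S B (i0 : 'I_n) (u : nat -> forall i, dual (dual (E i)))
    (l : seq 'I_n) (x : nat -> forall i, E i) :
  mform S B -> posform B -> i0 \in S -> uniq l -> {subset l <= S :\ i0} ->
  (forall k i, 0 [<=] u k i) -> (forall i, exists M : R, forall k, `|u k i| <= M) ->
  weakstar_null (fun k => u k i0) ->
  (forall k i, 0 [<=] x k i) -> bounded_coord x ->
  foldr (fun i => theta (u k i)) (theta (u k i0) B) l (x k) @[k --> \oo] --> (0 : R).
Proof.
move=> Bm B0 iS + + u0 bu wu.
have um k := mform_theta (u k i0) Bm iS.
have up k := posform_theta Bm iS B0 (u0 k i0).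
elim: l x => [|i l IH] x /=.
  move=> _ _ x0 bx; apply: (theta_weakstar_cvg0 (T := S :\ i0) Bm) => //.
  by move=> i k ->.
move=> /andP[il ul] lS x0 bx.
have lS' : {subset l <= S :\ i0} by move=> j jl; rewrite lS// in_cons jl orbT.
have gm k := mform_foldr_theta (u k) (um k) ul lS'.
have gp k := posform_foldr_theta (um k) ul lS' (up k) (u0 k).
have il' : i \in remove (S :\ i0) l by rewrite in_remove il lS// mem_head.
have [M uM] := bu i; apply: (dual_bounded_cvg0 uM).
apply: norm_cvg0_ge0 => [k|t t0 t1].
  exact: slice_ge0 (gm k) il' (gp k) _.
have := IH _ ul lS' (fun k => dfwith_ge0 (x0 k) (t0 k)) (bounded_coord_dfwith bx t1).
by under eq_cvg do rewrite -(sliceE _ _ (gm _) il').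
Qed.

End Forms.

(** * Positive multilinear operators and their extensions *)

Section PositiveMultilinear.
Context {R : realType} {n : nat} {E : 'I_n -> banachLatticeType R}.
Implicit Types (x y : forall i, E i).

(** Built by successive replacements, so that inductions on [l] change one variable at a time. *)
Definition mix (l : seq 'I_n) y x : forall i, E i :=
  foldr (fun i z => dfwith z i (y i)) x l.

Lemma mixE (l : seq 'I_n) y x (j : 'I_n) : mix l y x j = if j \in l then y j else x j.
Proof.
elim: l => //= i l IH; rewrite in_cons; have [<-|ij] := eqVneq i j.
  by rewrite dfwithin.
by rewrite dfwithout.
Qed.

Lemma mix_enum y x : mix (enum 'I_n) y x = y.
Proof. by apply/functional_extensionality_dep => i; rewrite mixE mem_enum. Qed.

Context {F : banachLatticeType R} (A : (forall i, E i) -> F).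

Section Multilinear.
Hypothesis lA : multilinear A.

Lemma multilinearD (i : 'I_n) x (s t : E i) :
  A (dfwith x i (s + t)) = A (dfwith x i s) + A (dfwith x i t).
Proof. by have := lA x 1 s t; rewrite !scale1r. Qed.

Lemma multilinear0 (i : 'I_n) x : A (dfwith x i 0) = 0.
Proof.
by have /eqP := multilinearD x (0 : E i) 0; rewrite addr0 -subr_eq0 opprD addNKr oppr_eq0 => /eqP.
Qed.

Lemma multilinearZ (i : 'I_n) x a (t : E i) :
  A (dfwith x i (a *: t)) = a *: A (dfwith x i t).
Proof. by have := lA x a t 0; rewrite !addr0 multilinear0 addr0. Qed.

Lemma multilinearB (i : 'I_n) x (s t : E i) :
  A (dfwith x i (s - t)) = A (dfwith x i s) - A (dfwith x i t).
Proof. by rewrite multilinearD -scaleN1r multilinearZ scaleN1r. Qed.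

Lemma multilinear_scale (c : 'I_n -> R) x :
  A (fun i => c i *: x i) = (\prod_i c i) *: A x.
Proof.
rewrite -(mix_enum (fun i => c i *: x i) x) -big_enum/=.
elim: (enum 'I_n) (enum_uniq 'I_n) => [|i l IH] /=; first by rewrite big_nil scale1r.
move=> /andP[il /IH lA']; rewrite multilinearZ big_cons -scalerA -lA'; congr (_ *: A _).
rewrite -[in RHS](dfwith_id (mix l _ x) i); congr (dfwith _ _ _).
by rewrite mixE (negbTE il).
Qed.

End Multilinear.

Hypothesis pA : positive_multilinear A.

(** The coordinates are raised from [x] to [y] one at a time; each increment is [A] at a positive
    tuple. *)
Lemma positive_multilinear_le x y :
  (forall i, 0 [<=] x i) -> (forall i, x i [<=] y i) -> A x [<=] A y.
Proof.
have [lA A0] := pA; move=> x0 xy; rewrite -(mix_enum y x).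
elim: (enum 'I_n) => [|i l IH] /=; first exact: bl_lexx.
apply: (bl_trans IH); rewrite -[X in A X [<=] _](dfwith_id (mix l y x) i).
have xm j : x j [<=] mix l y x j by rewrite mixE; case: ifP; rewrite ?bl_lexx.
rewrite -bl_subr_ge0 -multilinearB//; apply: A0 => j.
apply: dfwith_ge0 => [k|]; first exact: bl_trans (x0 k) (xm k).
by rewrite bl_subr_ge0 mixE; case: ifP; rewrite ?bl_lexx.
Qed.

Lemma positive_multilinear_modulus x : modulus (A x) [<=] A (fun i => modulus (x i)).
Proof.
have [lA A0] := pA.
(* [l] lists the coordinates of unknown sign; each is split into its positive and negative parts. *)
suff : forall l : seq 'I_n, (forall i, i \notin l -> 0 [<=] x i) ->
    modulus (A x) [<=] A (fun i => modulus (x i)).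
  by move=> h; apply: (h (enum 'I_n)) => i; rewrite mem_enum.
move=> l; elim: l x => [|i l IH] x xl.
  have -> : (fun i => modulus (x i)) = x.
    by apply/functional_extensionality_dep => i; rewrite modulus_id// xl.
  rewrite modulus_id ?bl_lexx//; apply: A0 => i; exact: xl.
have part (t : E i) : 0 [<=] t ->
    modulus (A (dfwith x i t)) [<=] A (dfwith (fun j => modulus (x j)) i t).
  move=> t0; have -> : dfwith (fun j => modulus (x j)) i t = fun j => modulus (dfwith x i t j).
    apply/functional_extensionality_dep => j; have [<-|ij] := eqVneq i j.
      by rewrite !dfwithin modulus_id.
    by rewrite !dfwithout.
  apply: IH => j jl; have [<-|ij] := eqVneq i j; first by rewrite dfwithin.
  by rewrite dfwithout// xl// in_cons negb_or eq_sym ij.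
rewrite -{1}(dfwith_id x i) (ppart_subE (x i)) multilinearB//.
apply: bl_trans (modulusD _ _) _; rewrite modulusN.
apply: (bl_trans (bl_leD (part _ (ppart_ge0 _)) (part _ (ppart_ge0 _)))).
rewrite -multilinearD// -[X in _ [<=] A X](dfwith_id _ i).
apply: positive_multilinear_le => j.
  by apply: dfwith_ge0 => [k|]; rewrite ?modulus_ge0 ?bl_addr_ge0 ?ppart_ge0.
have [<-|ij] := eqVneq i j; first by rewrite !dfwithin ppart_add_le.
by rewrite !dfwithout// bl_lexx.
Qed.

Lemma positive_multilinear_norm x : `|A x| <= `|A (fun i => modulus (x i))|.
Proof.
apply: modulus_ler_norm; apply: (bl_trans (positive_multilinear_modulus x)).
exact: modulus_ge.
Qed.

(* Otherwise A is unbounded along some positive x k in the unit balls, whereas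
   all the 2^-k x k have a common upper bound. *)
Lemma positive_multilinear_bounded_ball : exists2 M : R, 0 <= M &
  forall x, (forall i, 0 [<=] x i) -> (forall i, `|x i| <= 1) -> `|A x| <= M.
Proof.
have [lA A0] := pA; apply: contrapT => nM.
(* [x k] witnesses the failure of the bound [k * 2^(k n)]; the power [n] offsets the scaling by
   [2^-k] in all [n] variables. *)
have /choice[x xP] (k : nat) : exists x, [/\ forall i, 0 [<=] x i,
    forall i, `|x i| <= 1 & k%:R < (2^-1 ^+ k) ^+ n * `|A x|].
  apply: contrapT => nx; apply: nM; exists (k%:R / (2^-1 ^+ k) ^+ n).
    by rewrite divr_ge0// !exprn_ge0// invr_ge0.
  move=> x x0 x1; rewrite ler_pdivlMr ?exprn_gt0 ?invr_gt0// leNgt mulrC.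
  by apply/negP => lt; apply: nx; exists x.
have x0 k i : 0 [<=] x k i by have [] := xP k.
have x1 k i : `|x k i| <= 1 by have [] := xP k.
pose z i := projT1 (cid (dominating_sum (x0^~ i) (x1^~ i))).
have zP i k : (2^-1 ^+ k : R) *: x k i [<=] z i.
  exact: (projT2 (cid (dominating_sum (x0^~ i) (x1^~ i)))).
have p2 k : 0 <= (2^-1 ^+ k : R) by rewrite exprn_ge0// invr_ge0.
(* For this [k] the contradiction is [k < |A (2^-k x k)| <= |A z| < k]. *)
pose k := Num.Def.archi_bound `|A z|.
have Az : `|A z| < k%:R by apply: archi_boundP.
have [_ _] := xP k; rewrite ltNge => /negP; apply.
apply: le_trans (ltW Az).
have -> : (2^-1 ^+ k) ^+ n * `|A (x k)| = `|A (fun i => (2^-1 ^+ k : R) *: x k i)|.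
  rewrite (multilinear_scale lA (fun=> 2^-1 ^+ k)) normrZ prodr_const card_ord.
  by rewrite ger0_norm // exprn_ge0.
have w0 i : 0 [<=] (2^-1 ^+ k : R) *: x k i by rewrite bl_scaler_ge0.
by apply: ge0_ler_norm; [exact: A0|exact: positive_multilinear_le].
Qed.

(** The moduli of the coordinates are normalised and the bound on the positive unit balls is used; a
    zero coordinate, which cannot be normalised, is treated apart. *)
Lemma positive_multilinear_bounded :
  exists M : R, forall x, `|A x| <= M * \prod_(i < n) `|x i|.
Proof.
have [lA _] := pA; have [M M0 AM] := positive_multilinear_bounded_ball.
exists M => x; have [/existsP[i /eqP xi]|] := boolP [exists i, x i == 0].
  rewrite -(dfwith_id x i) xi multilinear0// normr0 mulr_ge0//.
  by rewrite prodr_ge0.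
rewrite negb_exists => /forallP xn0.
apply: (le_trans (positive_multilinear_norm x)).
have -> : (fun i => modulus (x i)) = (fun i => `|x i| *: (`|x i|^-1 *: modulus (x i))).
  apply/functional_extensionality_dep => i.
  by rewrite scalerA divff ?normr_eq0 ?xn0// scale1r.
rewrite (multilinear_scale lA (fun i => `|x i|)) normrZ ger0_norm ?prodr_ge0// mulrC.
rewrite ler_wpM2r ?prodr_ge0//; apply: AM => i.
  by rewrite bl_scaler_ge0 ?modulus_ge0// invr_ge0.
by rewrite normrZ norm_modulus ger0_norm ?invr_ge0// mulVf ?normr_eq0 ?xn0.
Qed.

End PositiveMultilinear.

(** * The Aron-Berner extension of a bounded operator *)

Section AronBernerExtension.
Context {R : realType} {n : nat} {E : 'I_n -> banachLatticeType R}.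
Context {F : banachLatticeType R}.
Implicit Types (A B C : (forall i, E i) -> F) (u v : forall i, dual (dual (E i))).

Definition bounded_operator A : Prop :=
  exists M : R, forall x, `|A x| <= M * \prod_(i < n) `|x i|.

Lemma mform_comp A (y : dual F) : multilinear A -> bounded_operator A ->
  mform [set: 'I_n]%SET (fun x => y (A x)).
Proof.
move=> lA [M bA]; split.
- exists (`|y| * `|M|) => [|x]; first by rewrite mulr_ge0.
  rewrite (le_trans (ler_dual _ _))// -mulrA ler_wpM2l// (eq_bigl xpredT).
    by rewrite (le_trans (bA x))// ler_wpM2r ?ler_norm// prodr_ge0.
  by move=> i; rewrite finset.in_setT.
- by move=> i x _ a s t; rewrite lA dual_linear.
- move=> x z xz; congr (y (A _)); apply/functional_extensionality_dep => i.
  by apply: xz; rewrite finset.in_setT.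
Qed.

Lemma posform_comp A (y : dual F) : positive_multilinear A -> 0 [<=] y ->
  posform (fun x => y (A x)).
Proof. by move=> [_ A0] y0 x x0; apply: dual_ge0 => //; exact: A0. Qed.

Lemma aron_berner_foldr A u (y : dual F) : multilinear A -> bounded_operator A ->
  aron_berner A u y =
  foldr (fun i => theta (u i)) (fun x => y (A x)) (enum 'I_n) (fun=> 0).
Proof. by move=> lA [M bA]; rewrite (aron_bernerE _ _ lA bA). Qed.

Lemma foldr_theta_comb (S : {set 'I_n}) (B B' B'' : (forall i, E i) -> R) a u l x :
  mform S B -> mform S B' -> mform S B'' -> uniq l -> {subset l <= S} ->
  (forall x, B x = a * B' x + B'' x) ->
  foldr (fun i => theta (u i)) B l x =
  a * foldr (fun i => theta (u i)) B' l x + foldr (fun i => theta (u i)) B'' l x.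
Proof.
move=> Bm Bm' Bm'' + + BE; elim: l x => [//|i l IH] x /= /andP[il ul] lS.
have lS' : {subset l <= S} by move=> j jl; rewrite lS// in_cons jl orbT.
have h D : mform S D -> mform (remove S l) (foldr (fun i => theta (u i)) D l).
  by move=> Dm; exact: mform_foldr_theta.
have iS : i \in remove S l by rewrite in_remove il lS// mem_head.
apply: (theta_comb _ (h _ Bm) (h _ Bm') (h _ Bm'')) => // t.
exact: IH.
Qed.

(** [theta] is linear in its functional, and the operators applied after it preserve the combination
    by [theta_comb]. *)
Lemma foldr_theta_dfwith (S : {set 'I_n}) (B : (forall i, E i) -> R) a u
    (i : 'I_n) (s t : dual (dual (E i))) l x :
  mform S B -> uniq l -> {subset l <= S} -> i \in l ->
  foldr (fun j => theta (dfwith u i (a *: s + t) j)) B l x =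
  a * foldr (fun j => theta (dfwith u i s j)) B l x +
  foldr (fun j => theta (dfwith u i t j)) B l x.
Proof.
move=> Bm; elim: l x => [//|j l IH] x /= /andP[jl ul] lS.
have lS' : {subset l <= S} by move=> k kl; rewrite lS// in_cons kl orbT.
have h v := mform_foldr_theta v Bm ul lS'.
have jS : j \in remove S l by rewrite in_remove jl lS// mem_head.
have [ij _|ij] := eqVneq i j; last first.
  rewrite in_cons (negbTE ij)/= => il; rewrite !dfwithout//.
  by apply: (theta_comb _ (h _) (h _) (h _)) => // r; exact: IH.
(* The inner operators do not see the changed coordinate, as [i] occurs only once in the list. *)
subst j; have e (r : dual (dual (E i))) : foldr (fun j => theta (dfwith u i r j)) B l =
    foldr (fun j => theta (u j)) B l.
  elim: l jl {IH ul lS lS' h jS} => //= j l IH; rewrite in_cons negb_or => /andP[ij il].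
  by rewrite IH// dfwithout.
by rewrite !e !dfwithin.
Qed.

Lemma multilinear_aron_berner A : multilinear A -> bounded_operator A ->
  multilinear (aron_berner A).
Proof.
move=> lA bA i u a s t; apply: dualP => y.
rewrite dualDE dualZE !aron_berner_foldr//.
apply: (foldr_theta_dfwith _ _ _ _ _ (mform_comp y lA bA)).
- exact: enum_uniq.
- by move=> j _; rewrite finset.in_setT.
- by rewrite mem_enum.
Qed.

Lemma positive_multilinear_aron_berner A : positive_multilinear A ->
  positive_multilinear (aron_berner A).
Proof.
move=> pA; have bA := positive_multilinear_bounded pA; have [lA _] := pA.
split => [|u u0]; first exact: multilinear_aron_berner.
apply/dual_ge0P => y y0; rewrite aron_berner_foldr//.
apply: (posform_foldr_theta (mform_comp y lA bA)) => //.
- exact: enum_uniq.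
- by move=> j _; rewrite finset.in_setT.
- exact: posform_comp.
- by move=> i; exact: bl_lexx.
Qed.

Lemma aron_bernerB A B C u : multilinear A -> multilinear B -> multilinear C ->
  bounded_operator A -> bounded_operator B -> bounded_operator C ->
  (forall x, A x = B x - C x) ->
  aron_berner A u = aron_berner B u - aron_berner C u.
Proof.
move=> lA lB lC bA bB bC ABC; apply: dualP => y.
rewrite dualBE !aron_berner_foldr//.
rewrite (@foldr_theta_comb [set: 'I_n]%SET _ (fun x => y (C x)) (fun x => y (B x)) (-1)).
- by rewrite mulN1r addrC.
- exact: mform_comp.
- exact: mform_comp.
- exact: mform_comp.
- exact: enum_uniq.
- by move=> j _; rewrite finset.in_setT.
- by move=> x; rewrite ABC dualB mulN1r addrC.
Qed.

(** Applying [theta] at an embedded vector substitutes that vector for the variable. *)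
Lemma foldr_theta_embed (S : {set 'I_n}) (B : (forall i, E i) -> R) x z l :
  mform S B -> uniq l -> {subset l <= S} ->
  foldr (fun i => theta (embed (x i))) B l z = B (mix l x z).
Proof.
move=> Bm; elim: l z => [//|i l IH] z /= /andP[il ul] lS.
have lS' : {subset l <= S} by move=> k kl; rewrite lS// in_cons kl orbT.
have iS : i \in remove S l by rewrite in_remove il lS// mem_head.
have := sliceE z (x i) (mform_foldr_theta (fun i => embed (x i)) Bm ul lS') iS.
rewrite {1}/theta /slice /= => ->; rewrite IH//; congr B.
apply/functional_extensionality_dep => j; rewrite mixE.
have [<-|ij] := eqVneq i j; first by rewrite !dfwithin (negbTE il).
by rewrite !dfwithout// mixE.
Qed.

(** With [norm_embed], this carries norm convergence of the extension back to [A]. *)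
Lemma aron_berner_embed A x : multilinear A -> bounded_operator A ->
  aron_berner A (fun i => embed (x i)) = embed (A x).
Proof.
move=> lA bA; apply: dualP => y; rewrite aron_berner_foldr//.
rewrite (foldr_theta_embed _ _ (mform_comp y lA bA)) ?mix_enum ?enum_uniq//.
by move=> j _; rewrite finset.in_setT.
Qed.

End AronBernerExtension.

Section WeakstarNullModulus.
Context {R : realType} {E : banachLatticeType R}.

(** The modulus of [embed (x n)] lies below [embed (modulus (x n))], to which
    [disjoint_weakly_null_modulus] applies. *)
Lemma weakstar_null_embed_modulus (x : nat -> E) :
  disjoint_seq x -> weakly_null x ->
  weakstar_null (fun n => modulus (embed (x n))).
Proof.
move=> dx wx; apply: weakstar_null_ge0 => f f0.
apply: (@squeeze_cvg0 _ _ (fun n => f (modulus (x n)))).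
  move=> n; rewrite (dual_ge0 (modulus_ge0 _) f0)/=.
  have le : modulus (embed (x n)) [<=] embed (modulus (x n)).
    apply: modulus_le; apply/dual_leP => g g0; rewrite ?dualNE /= -?dualN.
      by rewrite dual_homo// modulus_ge.
    by rewrite dual_homo// modulus_geN.
  exact: (dual_le_ge0 le f0).
exact: disjoint_weakly_null_modulus.
Qed.

End WeakstarNullModulus.

(** * Norm convergence of the extensions *)

Section AronBernerNull.
Context {R : realType} {m : nat} {E : 'I_m.+1 -> banachLatticeType R}.
Context {F : banachLatticeType R}.
Hypothesis psE : forall i, positive_schur (dual (E i)).
Hypothesis hF : dual_positive_schur (dual F) \/
  (forall f : nat -> dual F, (forall n, 0 [<=] f n) -> disjoint_seq f ->
    bounded_fun f -> order_bounded f).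

Lemma positive_aron_berner_cvg0 (A : (forall i, E i) -> F)
    (u : nat -> forall i, dual (dual (E i))) :
  positive_multilinear A -> (forall k i, 0 [<=] u k i) -> bounded_coord u ->
  weakstar_null (fun k => u k ord_max) ->
  aron_berner A (u k) @[k --> \oo] --> (0 : dual (dual F)).
Proof.
move=> pA u0 bu wu; have bA := positive_multilinear_bounded pA.
have [lA _] := pA.
have [_ pAB] := positive_multilinear_aron_berner pA.
have z0 k : 0 [<=] aron_berner A (u k) by exact: pAB.
have wz : weakstar_null (fun k => aron_berner A (u k)).
  apply: weakstar_null_ge0 => y y0.
  (* The innermost operator is that of the last variable, the one carrying the weak*-null
     sequence. *)
  under eq_cvg do rewrite aron_berner_foldr// enum_ordSr foldr_rcons.
  apply: (foldr_theta_cvg0 psE (mform_comp y lA bA)) => //.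
  - exact: posform_comp.
  - by rewrite finset.in_setT.
  - have := enum_uniq 'I_m.+1; rewrite enum_ordSr rcons_uniq => /andP[_]; exact.
  - move=> i il; rewrite in_setD1 finset.in_setT andbT.
    have := enum_uniq 'I_m.+1; rewrite enum_ordSr rcons_uniq => /andP[+ _].
    by apply: contraNneq => <-.
  - by move=> k i; exact: bl_lexx.
  - by move=> i; exists 0 => k; rewrite normr0.
case: hF => [dsF|obF]; first exact: dsF.
apply: disjoint_test_cvg0 => // s e sk e0 de e1.
(* With [b] an upper bound of the disjoint test sequence, positivity squeezes the values between [0]
   and those at [b]. *)
have [|a [b ab]] := obF _ e0 de.
  by exists 1; split => // M M1 k _ /=; rewrite (le_trans (e1 k))// ltW.
apply: (@squeeze_cvg0 _ _ (fun k => aron_berner A (u (s k)) b)).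
  by move=> k; rewrite dual_ge0//= dual_homo//; have [] := ab k.
exact: (cvg_subseq sk (wz b)).
Qed.

Lemma bounded_coord_modulus (u : nat -> forall i, dual (dual (E i))) :
  bounded_coord u -> bounded_coord (fun k i => modulus (u k i)).
Proof. by move=> bu i; have [M uM] := bu i; exists M => k; rewrite norm_modulus. Qed.

Lemma regular_multilinearP (A : (forall i, E i) -> F) : regular_multilinear A ->
  multilinear A /\ bounded_operator A.
Proof.
move=> [B [C [pB pC ABC]]]; have [lB _] := pB; have [lC _] := pC; split.
  by move=> i x a s t; rewrite !ABC lB lC scalerBr opprD addrACA.
have [M BM] := positive_multilinear_bounded pB.
have [N CN] := positive_multilinear_bounded pC.
exists (M + N) => x; rewrite ABC (le_trans (ler_normB _ _))// mulrDl.
exact: lerD.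
Qed.

(** By positivity, the norm of the extension of [A] at [u k] is at most the sum of the norms of
    those of [B] and [C] at the moduli. *)
Lemma regular_aron_berner_cvg0 (A : (forall i, E i) -> F)
    (u : nat -> forall i, dual (dual (E i))) :
  regular_multilinear A -> bounded_coord u ->
  weakstar_null (fun k => modulus (u k ord_max)) ->
  aron_berner A (u k) @[k --> \oo] --> (0 : dual (dual F)).
Proof.
move=> rA bu wu; have [lA bA] := regular_multilinearP rA.
have [B [C [pB pC ABC]]] := rA.
have norm0 (D : (forall i, E i) -> F) : positive_multilinear D ->
    `|aron_berner D (fun i => modulus (u k i))| @[k --> \oo] --> (0 : R).
  move=> pD; pose v k i := modulus (u k i).
  have v0 k i : 0 [<=] v k i by exact: modulus_ge0.
  exact: cvg0_norm (positive_aron_berner_cvg0 pD v0 (bounded_coord_modulus bu) wu).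
apply: norm_cvg0.
apply: (@squeeze_cvg0 _ _ (fun k => `|aron_berner B (fun i => modulus (u k i))|
                                  + `|aron_berner C (fun i => modulus (u k i))|)).
  move=> k; rewrite normr_ge0/= (aron_bernerB (u k) lA (proj1 pB) (proj1 pC))//;
    try exact: positive_multilinear_bounded.
  rewrite (le_trans (ler_normB _ _))// lerD//.
    exact: (positive_multilinear_norm (positive_multilinear_aron_berner pB)).
  exact: (positive_multilinear_norm (positive_multilinear_aron_berner pC)).
by apply: cvg0D; exact: norm0.
Qed.

End AronBernerNull.

Theorem theorem3p10 (R : realType) (m : nat)
    (E : 'I_m.+1 -> banachLatticeType R) (F : banachLatticeType R)
    (A : (forall i, E i) -> F) :
  (forall i, positive_schur (dual (E i))) ->
  dual_positive_schur (dual F) \/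
    (forall f : nat -> dual F, (forall n, 0 [<=] f n) -> disjoint_seq f ->
      bounded_fun f -> order_bounded f) ->
  regular_multilinear A ->
  (forall x : nat -> forall i, dual (dual (E i)),
    (forall n, 0 [<=] x n ord_max) ->
    weakstar_null (fun n => x n ord_max) ->
    (forall k : 'I_m.+1, (k < m)%N -> bounded_fun (fun n => x n k)) ->
    `|aron_berner A (x n)| @[n --> \oo] --> (0 : R)) /\
  almost_dunford_pettis A /\
  almost_dunford_pettis (aron_berner A).
Proof.
move=> psE hF rA; have [lA bA] := regular_multilinearP rA.
have AB0 := regular_aron_berner_cvg0 psE hF rA.
split; last split; last split; last 1 first.
(* For disjoint sequences in the biduals, weak nullity passes to moduli, and it implies weak*
   nullity. *)
- move=> u du wu; apply: AB0 => [i|]; first exact: weakly_null_bounded.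
  by apply: weakly_null_weakstar; exact: disjoint_weakly_null_modulus.
- move=> x x0 wx bx; apply: cvg0_norm; apply: AB0 => [i|].
    have [im|] := ltnP i m; first exact: bounded_fun_ex (bx i im).
    (* The remaining index is the last one, where boundedness follows from weak* nullity. *)
    rewrite leq_eqVlt ltnNge -ltnS ltn_ord orbF => /eqP mi.
    have -> : i = ord_max by apply: val_inj.
    exact: weakstar_null_bounded.
  have -> : (fun n => modulus (x n ord_max)) = (fun n => x n ord_max) => //.
  by apply/funext => n; exact: modulus_id.
- split=> // x dx wx.
  (* The norms of [A] are read on its extension along the canonical embeddings. *)
  apply: norm_cvg0; have -> : (fun n => `|A (x n)|) =
      (fun n => `|aron_berner A (fun i => embed (x n i))|).
    by apply/funext => n; rewrite aron_berner_embed// norm_embed.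
  apply: cvg0_norm; apply: AB0 => [i|].
    by apply: weakstar_null_bounded; exact: weakly_null_embed.
  exact: weakstar_null_embed_modulus.
- exact: multilinear_aron_berner.
Qed.
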